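(* Let $\nu$ be a probability measure on $\mathbb{R}^n$ and suppose $\mathcal{I}(\nu,\alpha)<\infty$ for some $\frac12<\alpha<1$. Then for any $1$-Lipschitz function $f:\mathbb{R}^n\to\mathbb{R}$ and any $1\le\beta<\frac{\alpha}{1-\alpha}$, there exists a constant $C_1(\alpha,\beta,\mathcal{I}(\nu,\alpha))<\infty$ such that $$\mathbb{E}_\nu[|f-m_\nu(f)|^\beta]\le C_1(\alpha,\beta,\mathcal{I}(\nu,\alpha))\cdot \mathbb{E}_\nu[|\nabla f|]^{\alpha-\beta(1-\alpha)}.$$ Here one can take $$C_1(\alpha,\beta,\mathcal{I}(\nu,\alpha))=\mathcal{I}(\nu,\alpha)^{\alpha-\beta(1-\alpha)}\left[1+2\,\mathcal{I}(\nu,\alpha)^{\frac{\beta}{\alpha}}\left(\frac{\alpha}{1-\alpha}\right)^{\beta}\left(\frac{\alpha}{\alpha-\beta(1-\alpha)}\right)\right].$$ Equivalently, $\mathcal{C}_1(\nu,\alpha-\beta(1-\alpha),\beta)\le C_1(\alpha,\beta,\mathcal{I}(\nu,\alpha))$.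
   Context: $\mathbb{E}_\nu$ is expectation under $\nu$. The median is $m_\nu(f)=\inf\{x\in\mathbb{R}: \mathbb{P}_\nu(f\le x)\ge\frac12\}$. $f$ is $1$-Lipschitz ($f\in\operatorname{Lip}_1(\mathbb{R}^n)$) if $|f(x)-f(y)|\le|x-y|_2$ for all $x,y$ (Euclidean norm), and $|\nabla f(x)|=\limsup_{y\to x}\frac{|f(x)-f(y)|}{|x-y|}$. For measurable $A\subseteq\mathbb{R}^n$ let $A^\epsilon=\{x: d(x,A)\le\epsilon\}$ ($d$ Euclidean distance) and $\nu(A^+)=\liminf_{\epsilon\to0^+}\frac{\nu(A^\epsilon)-\nu(A)}{\epsilon}$. For $0<\alpha\le1$ the $\alpha$-Cheeger constant is $$\mathcal{I}(\nu,\alpha)=\sup_{A\subseteq\mathbb{R}^n}\frac{\min\{\nu(A),1-\nu(A)\}}{\nu(A^+)^\alpha}\in[0,\infty].$$ For $0<a\le1$ and $\beta\ge1$ the $(a,\beta)$-Poincaré constant is $$\mathcal{C}_1(\nu,a,\beta)=\sup_{f\in\operatorname{Lip}_1(\mathbb{R}^n)}\frac{\mathbb{E}_\nu[|f-m_\nu(f)|^\beta]}{(\mathbb{E}_\nu[|\nabla f|])^a}.$$ In these suprema a ratio $0/0$ is read as $0$ and $c/0$ with $c>0$ as $+\infty$. *)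

(* Defs.v *)
From HB Require Import structures.
From mathcomp Require Import all_boot all_order all_algebra.
From mathcomp Require Import all_classical all_reals all_analysis.
Set Implicit Arguments.
Unset Strict Implicit.
Unset Printing Implicit Defensive.
Import Order.TTheory GRing.Theory Num.Theory.
Import numFieldNormedType.Exports.
Local Open Scope classical_set_scope.
Local Open Scope ring_scope.

(* R^n with its Borel sigma-algebra. *)
Notation Rn R n := (g_sigma_algebraType (@open 'rV[R]_n)).

(* The library norm on 'rV[R]_n is the sup norm, hence this definition; the
   two norms induce the same topology, so that [open] and [x^'] can be used. *)
Definition enorm (R : realType) (n : nat) (x : 'rV[R]_n) : R :=
  Num.sqrt (\sum_(i < n) x ord0 i ^+ 2).

Definition lip1 (R : realType) (n : nat) (f : 'rV[R]_n -> R) : Prop :=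
  forall x y, `|f x - f y| <= enorm (x - y).

Definition grad_norm (R : realType) (n : nat) (f : 'rV[R]_n -> R)
    (x : 'rV[R]_n) : \bar R :=
  limf_esup (fun y => (`|f x - f y| / enorm (x - y))%:E) x^'.

Definition median (R : realType) (n : nat) (nu : probability (Rn R n) R)
    (f : 'rV[R]_n -> R) : R :=
  inf [set t : R | ((2^-1)%:E <= nu [set x | (f x <= t)%R])%E].

(* d(x, set0) = +oo *)
Definition dist_set (R : realType) (n : nat) (x : 'rV[R]_n)
    (A : set 'rV[R]_n) : \bar R :=
  ereal_inf [set (enorm (x - y))%:E | y in A].

Definition enlargement (R : realType) (n : nat) (A : set 'rV[R]_n) (e : R) :
    set 'rV[R]_n :=
  [set x | (dist_set x A <= e%:E)%E].

Definition boundary_measure (R : realType) (n : nat)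
    (nu : probability (Rn R n) R) (A : set 'rV[R]_n) : \bar R :=
  limf_einf (fun e : R => ((nu (enlargement A e) - nu A) / e%:E)%E) 0^'+.

(* In both suprema below, division in \bar R is multiplication by the inverse,
   with 0^-1 = +oo, +oo^-1 = 0 and 0 * +oo = 0: hence 0 / 0 = 0 and
   c / 0 = +oo for c > 0. *)
Definition cheeger (R : realType) (n : nat) (nu : probability (Rn R n) R)
    (alpha : R) : \bar R :=
  ereal_sup [set (mine (nu A) (1 - nu A) / boundary_measure nu A `^ alpha)%E
            | A in (measurable : set (set (Rn R n)))].

Definition poincare (R : realType) (n : nat) (nu : probability (Rn R n) R)
    (a beta : R) : \bar R :=
  ereal_sup [set ('E_nu[fun x => (`|f x - median nu f| `^ beta)%R]
                  / (\int[nu]_x grad_norm f x) `^ a)%E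
            | f in [set f : 'rV[R]_n -> R | lip1 f]].

Definition C1_const (R : realType) (alpha beta I : R) : R :=
  let a := alpha - beta * (1 - alpha) in
  I `^ a * (1 + 2 * I `^ (beta / alpha) * (alpha / (1 - alpha)) `^ beta
                * (alpha / a)).

(* Main.v *)
Require Import Defs.
From HB Require Import structures.
From mathcomp Require Import all_boot all_order all_algebra.
From mathcomp Require Import all_classical all_reals all_analysis.
From mathcomp Require Import measurable_realfun.
From mathcomp Require Import ring lra.
Set Implicit Arguments.
Unset Strict Implicit.
Unset Printing Implicit Defensive.
Import Order.TTheory GRing.Theory Num.Theory.
Import numFieldNormedType.Exports.
Local Open Scope classical_set_scope.
Local Open Scope ring_scope.

(* Write [phi = f - median], [A_t = {phi >= t}], let [phi_k] be the supremum of
   [phi] over the ball of radius [1/(k+1)], and let [g t] be the liminf of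
   [(k+1) nu(phi < t <= phi_k)].  The enlargement of [A_t] lies in
   [{phi_k >= t}], so the Cheeger inequality reads
   [min(nu A_t, 1 - nu A_t) <= I (g t)^alpha], while Fatou's lemma, used once in
   [t] and once (reversed) in [x], gives the coarea inequality
   [\int psi g <= \int psi(phi) |grad f|].
   With [S = E |phi|^beta] (truncated, so that it is finite) and
   [w t = beta |t|^(beta-1)], the layer cake formula and Young's inequality give
   [S <= I \int w g^alpha <= k \int (|t|^beta + r) g + \int err].  As
   [|grad f| <= 1], coarea bounds the first term by [k (S + r E|grad f|)], which is
   absorbed for [k = 1 - alpha / beta], and [\int err] is an explicit power
   integral.  Optimizing in [r] gives a bound
   [c I^(beta/alpha) (E|grad f|)^(1 - beta/p)], [p = alpha / (1 - alpha)], which an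
   elementary convexity argument compares with the stated constant. *)

(** * The elementary inequality on constants *)

Section RealInequalities.
Variable R : realType.
Implicit Types x y t : R.

Lemma ln_le_subr1 x : 0 < x -> ln x <= x - 1.
Proof.
move=> x0; have := @le_ln1Dx R (x - 1).
by rewrite addrCA subrr addr0; apply; lra.
Qed.

Lemma ln_ge_1subV x : 0 < x -> 1 - x^-1 <= ln x.
Proof.
move=> x0; have := @ln_le_subr1 x^-1; rewrite invr_gt0 => /(_ x0).
by rewrite lnV ?posrE//; lra.
Qed.

(** The tangent to [expR] at [(1 - t) * y], evaluated at [y] and at [0], gives two bounds; their
    average with weights [1 - t] and [t] is the claim. *)
Lemma expR_convex_le t y : 0 <= t <= 1 ->
  expR ((1 - t) * y) <= (1 - t) * expR y + t.
Proof.
move=> /andP[t0 t1].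
have h1 : expR ((1 - t) * y) * (1 + t * y) <= expR y.
  rewrite [in leRHS](_ : y = (1 - t) * y + t * y); last ring.
  by rewrite expRD ler_wpM2l ?expR_ge0// expR_ge1Dx.
have h2 : expR ((1 - t) * y) * (1 - (1 - t) * y) <= 1.
  rewrite -[leRHS]expR0 -[in leRHS](subrr ((1 - t) * y)).
  by rewrite expRD ler_wpM2l ?expR_ge0// expR_ge1Dx.
nra.
Qed.

Lemma powRE_gt0 x y : 0 < x -> x `^ y = expR (y * ln x).
Proof. by move=> x0; rewrite /powR gt_eqF. Qed.

(* With [k = 1 - al / be] and the optimal radius [r], the absorption argument
   bounds the moment by [2^(be/p) m I^(be/al) D^(1 - be/p) p / (p - be)]; the
   left-hand side is [ln m]. *)
Lemma ln_optimal_constant_le (al be p : R) : 0 < al < 1 -> 1 <= be ->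
  p * (1 - al) = al -> be < p ->
  (1 + be) * ln be + (be - 1) * ln al + (1 - be / al) * ln (1 - al / be)
    - be / p * ln (p + 1)
  <= (be - 1) * ln p - (1 - be / p) * (be - 1) + (2 - be / p) * ln be.
Proof.
move=> /andP[al0 al1] be1 pal bep.
have p0 : 0 < p by lra.
have alE : al = p / (p + 1) by apply: (canRL (mulfK _)); lra.
have k0 : 0 < 1 - al / be by rewrite subr_gt0 ltr_pdivrMr; lra.
(* The point of application is chosen because [be / al - 1] equals
   [be / p * ((1 - al / be) * (p + 1))]: multiplying by it cancels the inverse and leaves
   [be / p * be]. *)
have h : 1 - ((1 - al / be) * (p + 1) / be)^-1 <=
    ln (1 - al / be) + ln (p + 1) - ln be.
  rewrite -lnM ?posrE//; last lra.
  rewrite -ln_div ?posrE; [|apply: mulr_gt0; lra|lra].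
  by apply: ln_ge_1subV; rewrite divr_gt0 ?mulr_gt0//; lra.
have lnal : ln al = ln p - ln (p + 1) by rewrite alE ln_div ?posrE//; lra.
have bal : be / al = be + be / p.
  rewrite alE; field; lra.
have b1 : be / al - 1 = be / p * ((1 - al / be) * (p + 1)).
  by rewrite alE; field; lra.
have b10 : 0 <= be / al - 1 by rewrite subr_ge0 ler_pdivlMr; lra.
have {}h := ler_wpM2l b10 h.
have E : (be / al - 1) * (1 - ((1 - al / be) * (p + 1) / be)^-1) =
   be / al - 1 - be / p * be.
  rewrite mulrBr mulr1; congr (_ - _).
  by rewrite b1; field; lra.
rewrite {}E in h.
rewrite lnal bal; rewrite bal in h.
set s := be / p in h *.
set A := ln (1 - al / be) in h *.
nra.
Qed.

(* The bound of [ln_optimal_constant_le], normalized so that the two conclusions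
   are the coefficient conditions left after applying [expR_convex_le]. *)
Lemma optimal_exponent_le (al be p : R) : 0 < al < 1 -> 1 <= be ->
  p * (1 - al) = al -> be < p ->
  let Z := be / p * ln 2 - ln p + al ^+ 2 * (1 - be / p) * ln p
    - (1 - be / p) * (be - 1) + (2 - be / p) * ln be in
  Z <= ln 2 /\ Z <= ln be - 2 * ln al.
Proof.
move=> /andP[al0 al1] be1 pal bep.
have p0 : 0 < p by lra.
have alE : al = p / (p + 1) by apply: (canRL (mulfK _)); lra.
have s01 : 0 <= be / p <= 1.
  by rewrite divr_ge0 ?ler_pdivrMr ?mul1r//; lra.
have lnp0 : 0 <= ln p by apply: ln_ge0; lra.
have lnbe0 : 0 <= ln be by apply: ln_ge0; lra.
have lnbep : ln be <= ln p by rewrite ler_ln ?posrE; lra.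
have ln21 : ln 2 <= 1 :> R by have := @ln_le_subr1 2; lra.
have lnbe : ln be <= be - 1 by apply: ln_le_subr1; lra.
have lnbe2 : ln be - ln 2 <= be / 2 - 1.
  by rewrite -ln_div ?posrE; [apply: ln_le_subr1|..]; lra.
have lnal : - ln al = ln (p + 1) - ln p by rewrite alE ln_div ?posrE//; lra.
have lnal0 : ln al <= 0 by apply: ln_le0; lra.
have ln2p : ln 2 + ln p <= 2 * ln (p + 1).
  have -> : 2 * ln (p + 1) = ln ((p + 1) * (p + 1)) by rewrite lnM ?posrE; lra.
  by rewrite -lnM ?posrE ?ler_ln ?posrE; nra.
move=> Z; set s := be / p in s01 Z *.
have al2 : al ^+ 2 * (1 - s) * ln p <= (1 - s) * ln p.
  rewrite -mulrA ler_piMl//; first by rewrite mulr_ge0//; lra.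
  by rewrite expr2; nra.
have Z1 : Z <= s * ln 2 - s * ln p - (1 - s) * (be - 1) + (2 - s) * ln be.
  by rewrite /Z; lra.
split; apply: (le_trans Z1); first by nra.
(* Only a positive [ln 2 - ln p] matters; then [s <= 1] and [2 * p <= (p + 1) ^ 2] give the bound,
   since [al = p / (p + 1)]. *)
have : s * (ln 2 - ln p) <= - 2 * ln al.
  have [h|h] := leP (ln 2 - ln p) 0; first by nra.
  by nra.
nra.
Qed.

(** The hypothesis trades a term linear in [r] against one of negative exponent [1 - p / be]. At the
    minimizer [D] appears with exponent [1 - be / p]; as [D <= 1], this may be lowered to
    [al * (1 - be / p)], the exponent in the conclusion. *)
Lemma optimize_radius (al be p I D S : R) : 0 < al < 1 -> 1 <= be ->
  p = al / (1 - al) -> be < p -> 0 < I -> 0 < D <= 1 ->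
  (forall r, 0 < r -> al / be * S <= (1 - al / be) * r * D
    + 2 * (I `^ (p + 1) * (al / (1 - al / be)) `^ p * be `^ (p + 1)
           / ((p + 1) * (p - be))) * r `^ (1 - p / be)) ->
  S <= C1_const al be I * D `^ (al - be * (1 - al)).
Proof.
move=> al01 be1 pE bep I0 /andP[D0 D1] hS.
have [al0 al1] := andP al01.
have pal : p * (1 - al) = al by rewrite pE; field; lra.
have p0 : 0 < p by lra.
have k0 : 0 < 1 - al / be by rewrite subr_gt0 ltr_pdivrMr; lra.
have bal : be / al = be + be / p.
  have alE : al = p / (p + 1) by apply: (canRL (mulfK _)); lra.
  by rewrite alE; field; lra.
have ale : al - be * (1 - al) = al * (1 - be / p).
  by rewrite -[in be * (1 - al)](mulKf (lt0r_neq0 p0) (1 - al)) pal; ring.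
have s01 : 0 < 1 - be / p < 1.
  by rewrite subr_gt0 ltr_pdivrMr// mul1r bep/= gtrBl divr_gt0//; lra.
have a0 : 0 < al - be * (1 - al) by rewrite ale mulr_gt0//; lra.
(* [expR (be / p * q)] is the minimizer of the right-hand side of [hS]. *)
pose q := ln 2 + (p + 1) * ln I + p * (ln al - ln (1 - al / be)) + p * ln be
   - ln (1 - al / be) - ln (p + 1) - ln D.
have h := hS (expR (be / p * q)) (expR_gt0 _).
(* Stationarity: at the minimizer the power term is [be / (p - be)] times the linear one, so their
   sum carries the factor [p / (p - be)]. *)
have E2 : 2 * (I `^ (p + 1) * (al / (1 - al / be)) `^ p * be `^ (p + 1)
           / ((p + 1) * (p - be))) * expR (be / p * q) `^ (1 - p / be) =
   (1 - al / be) * expR (be / p * q) * D * (be / (p - be)).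
  rewrite !powRE_gt0 ?expR_gt0 ?divr_gt0//; last lra.
  rewrite expRK ln_div ?posrE//.
  have : 2 * expR ((p + 1) * ln I) * expR (p * (ln al - ln (1 - al / be)))
     * expR ((p + 1) * ln be) * expR ((1 - p / be) * (be / p * q)) =
     (p + 1) * (1 - al / be) * D * be * expR (be / p * q).
    rewrite -[X in X * _ * _ * _ * _](@lnK R) ?posrE//.
    rewrite -[X in _ = X * _ * _ * _ * _](@lnK R) ?posrE; last lra.
    rewrite -[X in _ = _ * X * _ * _ * _](@lnK R) ?posrE//.
    rewrite -[X in _ = _ * _ * X * _ * _](@lnK R) ?posrE//.
    rewrite -[X in _ = _ * _ * _ * X * _](@lnK R) ?posrE; last lra.
    rewrite -!expRD; congr expR.
    rewrite (_ : (1 - p / be) * (be / p * q) = be / p * q - q); last by field; lra.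
    set w := be / p * q; rewrite /q; lra.
  set e1 := expR ((p + 1) * ln I); set e2 := expR (p * _).
  set e3 := expR ((p + 1) * ln be); set e4 := expR ((1 - p / be) * _).
  move=> h'.
  transitivity (2 * e1 * e2 * e3 * e4 / ((p + 1) * (p - be))); first by field; lra.
  by rewrite h'; field; lra.
rewrite {}E2 in h.
pose Y := ln be - ln al + ln (1 - al / be) + ln D + be / p * q.
have SY : S <= p / (p - be) * expR Y.
  have -> : expR Y = be / al * ((1 - al / be) * D * expR (be / p * q)).
    rewrite /Y !expRD expRN !lnK ?posrE//; lra.
  rewrite -(@ler_pM2l _ (al / be)) ?divr_gt0//; last lra.
  apply: (le_trans h); rewrite le_eqVlt; apply/orP; left; apply/eqP.
  by field; lra.
apply: (le_trans SY).
rewrite /C1_const -pE.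
set a := al - be * (1 - al) in ale a0 *.
have -> : al / a = p / (p - be) by rewrite ale; field; lra.
rewrite !powRE_gt0//.
set L := p / (p - be).
have L0 : 0 < L by rewrite divr_gt0//; lra.
have lnD0 : ln D <= 0 by apply: ln_le0; lra.
pose y := be / al * ln I + be * ln p.
(* The weight [th] satisfies [th * (be / al) = a], so [(1 - th) * y] has exactly the [ln I] term
   left in [Y] once [a * ln I] is factored out. *)
pose th := a * al / be.
have th01 : 0 <= th <= 1.
  rewrite /th divr_ge0 ?mulr_ge0 ?ler_pdivrMr ?mul1r//=; try lra.
  by rewrite ale; nra.
have /= [] := optimal_exponent_le al01 be1 pal bep; set Z := (X in X <= ln 2).
rewrite -/Z => Z2 Zbe.
have YZ : Y - a * ln I - a * ln D <= (1 - th) * y + Z.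
  have opt := ln_optimal_constant_le al01 be1 pal bep.
  have sq : be / p * q = be / p * ln 2 + be / al * ln I
      + be * (ln al - ln (1 - al / be)) + be * ln be
      - be / p * ln (1 - al / be) - be / p * ln (p + 1) - be / p * ln D.
    by rewrite /q bal; field; lra.
  have ty : (1 - th) * y = be / al * ln I - a * ln I + be * ln p
      - al ^+ 2 * (1 - be / p) * ln p.
    by rewrite /th /y ale; field; lra.
  have lnD : (1 - be / p) * (1 - al) * ln D <= 0.
    by rewrite mulr_ge0_le0// mulr_ge0//; lra.
  rewrite ty /Y sq /Z {1 2 3}ale; move: opt lnD; rewrite !bal.
  set s := be / p; set lk := ln (1 - _); set lq := ln (p + 1); lra.
rewrite (_ : expR Y = expR (a * ln I) * expR (a * ln D) *
   expR (Y - a * ln I - a * ln D)); last by rewrite -!expRD; congr expR; ring.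
rewrite [leRHS](_ : _ = expR (a * ln I) * expR (a * ln D) *
   (1 + 2 * expR y * L)); last by rewrite /y [in RHS]expRD; ring.
rewrite mulrCA ler_wpM2l ?mulr_ge0 ?expR_ge0//.
apply: (@le_trans _ _ (L * (expR ((1 - th) * y) * expR Z))).
  by rewrite ler_wpM2l ?(ltW L0)// -expRD ler_expR.
apply: (@le_trans _ _ (L * (((1 - th) * expR y + th) * expR Z))).
  by rewrite ler_wpM2l ?(ltW L0)// ler_wpM2r ?expR_ge0// expR_convex_le.
(* The first bound on [Z] controls the coefficient of [expR y], the second the constant term: they
   account for the [2] and the [1] in [C1_const]. *)
have eZ2 : expR Z <= 2 by rewrite -[leRHS](@lnK R) ?posrE// ler_expR.
have eZbe : L * th * expR Z <= 1.
  have -> : L * th = al ^+ 2 / be by rewrite /th ale /L; field; lra.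
  rewrite -[X in X / be](@lnK R) ?posrE ?exprn_gt0//.
  rewrite -[X in _ / X](@lnK R) ?posrE; last lra.
  rewrite -expRN -!expRD -expR0 ler_expR lnXn// mulr2n.
  by move: Zbe; lra.
have : (1 - th) * expR Z <= 2.
  by apply: le_trans eZ2; rewrite ler_piMl ?expR_ge0//; lra.
move=> /(ler_wpM2r (mulr_ge0 (expR_ge0 y) (ltW L0))).
lra.
Qed.

End RealInequalities.

(** * Inferior and superior limits *)

Section Limits.
Variable R : realType.
Implicit Types (u v : (\bar R)^nat) (l : \bar R).
Local Open Scope ereal_scope.

Lemma limn_esup_le_near u l :
  (\forall k \near \oo, u k <= l) -> limn_esup u <= l.
Proof.
move=> ul; rewrite /limn_esup /limf_esup.
apply: (@le_trans _ _ (ereal_sup (u @` [set k | u k <= l]))).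
  by apply: ereal_inf_lbound; exists [set k | u k <= l].
by apply: ge_ereal_sup => _ [k /= h <-].
Qed.

Lemma limn_esup_lt_near u l : limn_esup u < l -> \forall k \near \oo, u k < l.
Proof.
move=> /ereal_inf_lt[_ [V Voo <-]] h.
apply: filterS Voo => k Vk.
by apply: le_lt_trans h; apply: ereal_sup_ubound; exists k.
Qed.

Lemma limn_einf_ge_near u l :
  (\forall k \near \oo, l <= u k) -> l <= limn_einf u.
Proof.
move=> lu; rewrite /limn_einf leeNr; apply: limn_esup_le_near.
by apply: filterS lu => k; rewrite leeN2.
Qed.

Lemma limn_einf_leZl (c : R) u : (0 <= c)%R -> (forall k, 0 <= u k) ->
  c%:E * limn_einf u <= limn_einf (fun k => c%:E * u k).
Proof.
rewrite le_eqVlt => /predU1P[<- u0|c0 _].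
  rewrite mul0e; apply: limn_einf_ge_near; apply: nearW => k.
  by rewrite mul0e.
rewrite -lee_pdivlMl//.
rewrite [leLHS](limf_einfE u \oo); apply: ge_ereal_sup => _ [V Voo <-].
rewrite lee_pdivlMl//; apply: limn_einf_ge_near.
apply: filterS Voo => k Vk; rewrite lee_pmul2l//.
by apply: ereal_inf_lbound; exists k.
Qed.

End Limits.

Lemma measurable_limn_einf d (T : measurableType d) (R : realType)
    (f : (T -> \bar R)^nat) : (forall k, measurable_fun [set: T] (f k)) ->
  measurable_fun [set: T] (fun x => limn_einf (f^~ x)).
Proof.
move=> mf; apply: measurableT_comp => //.
by apply: measurable_fun_limn_esup => k; exact: measurableT_comp.
Qed.

(* For nonnegative functions the library integral is a lower integral, so
   [grad_norm f] can be bounded from below without proving it measurable. *)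
Lemma ge0_le_lower_integral d (T : measurableType d) (R : realType)
    (mu : {measure set T -> \bar R})
    (f g : T -> \bar R) : (forall x, 0 <= f x <= g x)%E ->
  (\int[mu]_x f x <= \int[mu]_x g x)%E.
Proof.
move=> fg; rewrite !ge0_integralTE; last 2 first.
- by move=> x; case/andP: (fg x); exact: le_trans.
- by move=> x; case/andP: (fg x).
apply: ereal_sup_le => _ [h /= hf <-]; exists h => // x.
by apply: (le_trans (hf x)); case/andP: (fg x).
Qed.

Lemma integral_bounded d (T : measurableType d) (R : realType)
    (P : probability T R) (B : R) (f : T -> \bar R) :
  (forall x, 0 <= f x <= B%:E)%E ->
  (0 <= \int[P]_x f x <= B%:E /\ \int[P]_x f x \is a fin_num)%E.
Proof.
move=> fB.
have i0 : (0 <= \int[P]_x f x)%E by apply: integral_ge0 => x _; case/andP: (fB x).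
have iB : (\int[P]_x f x <= B%:E)%E.
  apply: (@le_trans _ _ (\int[P]_x (cst B%:E x))%E); first exact: ge0_le_lower_integral.
  by rewrite integral_cst//= probability_setT mule1.
by rewrite i0 iB ge0_fin_numE// (le_lt_trans iB)// ltry.
Qed.

Section ReverseFatou.
Context d (T : measurableType d) (R : realType) (nu : probability T R).
Local Open Scope ereal_scope.

(** Fatou's lemma for the nonnegative functions [B - f k]; [B] has finite integral under a
    probability, so it can be subtracted on both sides. *)
Lemma reverse_fatou (f : (T -> \bar R)^nat) (B : R) :
  (forall k, measurable_fun [set: T] (f k)) ->
  (forall k x, 0 <= f k x <= B%:E) ->
  limn_esup (fun k => \int[nu]_x f k x) <= \int[nu]_x limn_esup (f^~ x).
Proof.
move=> mf fB.
have sup0 x : 0 <= limn_esup (f^~ x).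
  apply: (@le_trans _ _ (limn_einf (f^~ x))); last exact: limn_einf_sup.
  by apply: limn_einf_ge_near; apply: nearW => k; case/andP: (fB k x).
have supB x : limn_esup (f^~ x) <= B%:E.
  by apply: limn_esup_le_near; apply: nearW => k; case/andP: (fB k x).
have msup : measurable_fun [set: T] (fun x => limn_esup (f^~ x)).
  exact: measurable_fun_limn_esup.
have bint g : measurable_fun [set: T] g -> (forall x, 0 <= g x <= B%:E) ->
    \int[nu]_x (B%:E - g x) = B%:E - \int[nu]_x g x.
  move=> mg gB; have iB : nu.-integrable [set: T] (cst B%:E).
    exact: finite_measure_integrable_cst.
  rewrite integralB//; last first.
    apply: le_integrable iB => //= x _; have /andP[g0 gb] := gB x.
    by rewrite gee0_abs// (le_trans gb)// lee_fin ler_norm.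
  by rewrite integral_cst//= probability_setT mule1.
have := @fatou _ _ _ nu setT measurableT (fun k x => B%:E - f k x).
have -> : (fun x => limn_einf (fun k => B%:E - f k x)) =
    (fun x => B%:E - limn_esup (f^~ x)).
  by apply/funext => x; rewrite limn_einf_shift// -limn_einfN.
rewrite bint//; last by move=> x; rewrite sup0 supB.
have -> : (fun k => \int[nu]_x (B%:E - f k x)) = (fun k => B%:E - \int[nu]_x f k x).
  by apply/funext => k; rewrite bint.
rewrite limn_einf_shift// (limn_einfN (fun k => \int[nu]_x f k x)) => h.
have : B%:E - \int[nu]_x limn_esup (f^~ x) <=
    B%:E - limn_esup (fun k => \int[nu]_x f k x).
  apply: h => [k|k x _]; first by apply: emeasurable_funB.
  by rewrite sube_ge0 ?orbT//; case/andP: (fB k x).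
by rewrite leeD2lE// leeN2.
Qed.

End ReverseFatou.

(** * A coarea inequality *)

(** Mass carried across the level [t] when [f] is replaced by [F k], per unit of radius
    [1 / (k + 1)]: a discrete perimeter of the superlevel set at [t]. *)
Definition level_flux d (T : measurableType d) (R : realType)
    (nu : probability T R) (f : T -> R) (F : (T -> R)^nat) (k : nat) (t : R)
    : \bar R :=
  (k.+1%:R%:E * nu [set x | (f x < t <= F k x)%R])%E.

(** With [F k] the supremum of [f] over the ball of radius [1 / (k + 1)], this is an upper slope of
    [f]. As a limsup of measurable functions it is a measurable minorant standing in for
    [grad_norm]. *)
Definition quotient_sup (T : Type) (R : realType)
    (f : T -> R) (F : (T -> R)^nat) (x : T) : \bar R :=
  limn_esup (fun k => (k.+1%:R * (F k x - f x))%:E).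

Section Coarea.
Context d (T : measurableType d) (R : realType) (nu : probability T R).
Variables (f : T -> R) (F : (T -> R)^nat).
Hypotheses (mf : measurable_fun [set: T] f)
  (mF : forall k, measurable_fun [set: T] (F k))
  (fF : forall k x, f x <= F k x <= f x + k.+1%:R^-1).
Local Open Scope ereal_scope.

Local Notation leb := (@lebesgue_measure R).
Local Notation TR := (T * measurableTypeR R)%type.

Lemma quotient_ge0_le1 k x : (0 <= k.+1%:R * (F k x - f x) <= 1)%R.
Proof.
have /andP[h1 h2] := fF k x.
rewrite mulr_ge0 ?subr_ge0//= -(@ler_pM2l _ k.+1%:R^-1) ?invr_gt0//.
by rewrite mulKf// mulr1 lerBlDl.
Qed.

Lemma quotient_sup_ge0_le1 x : 0 <= quotient_sup f F x <= 1.
Proof.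
apply/andP; split.
  apply: (@le_trans _ _ (limn_einf (fun k => (k.+1%:R * (F k x - f x))%:E))).
    apply: limn_einf_ge_near; apply: nearW => k.
    by rewrite lee_fin; case/andP: (quotient_ge0_le1 k x).
  exact: limn_einf_sup.
apply: limn_esup_le_near; apply: nearW => k.
by rewrite lee_fin; case/andP: (quotient_ge0_le1 k x).
Qed.

Lemma measurable_quotient_sup : measurable_fun [set: T] (quotient_sup f F).
Proof.
apply: measurable_fun_limn_esup => k; apply/measurable_EFinP.
by apply: measurable_funM => //; exact: measurable_funB.
Qed.

Lemma measurable_level_band (g h : T -> R) : measurable_fun [set: T] g ->
  measurable_fun [set: T] h ->
  measurable [set z : TR | (g z.1 < z.2 <= h z.1)%R].
Proof.
move=> mg mh.
have mb : measurable_fun [set: TR] (fun z : TR => (g z.1 < z.2)%R && (z.2 <= h z.1)%R).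
  apply: measurable_and; [apply: measurable_fun_ltr|apply: measurable_fun_ler] => //.
  - exact: (measurableT_comp mg measurable_fst).
  - exact: (measurableT_comp mh measurable_fst).
rewrite [X in measurable X](_ : _ = [set: TR] `&`
  (fun z : TR => (g z.1 < z.2)%R && (z.2 <= h z.1)%R) @^-1` [set true]).
  exact: mb.
by rewrite setTI; apply/seteqP; split.
Qed.

Lemma measurable_band (g h : T -> R) t : measurable_fun [set: T] g ->
  measurable_fun [set: T] h ->
  measurable [set x | (g x < t <= h x)%R].
Proof.
move=> mg mh; have := measurable_ysection t (measurable_level_band mg mh).
by congr measurable; apply/seteqP; split=> x /=; rewrite ysectionE /=.
Qed.

(** Up to the factor [k + 1], integrating [G] in [x] first gives [psi] times the flux, and in [t]
    first a weighted length of the band from [f x] to [F k x]; Tonelli's theorem links the two sides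
    of the coarea inequality. *)
Let G (psi : R -> R) (k : nat) (z : TR) : \bar R :=
  (psi z.2 * \1_[set z : TR | (f z.1 < z.2 <= F k z.1)%R] z)%:E.

Lemma measurable_level_weight (psi : R -> R) k : measurable_fun [set: R] psi ->
  measurable_fun [set: TR] (G psi k).
Proof.
move=> mpsi; apply/measurable_EFinP; apply: measurable_funM.
  exact: (measurableT_comp mpsi measurable_snd).
exact: measurable_indic (measurable_level_band mf (mF k)).
Qed.

Lemma level_weightE psi k t : (0 <= psi t)%R -> \int[nu]_x G psi k (x, t) =
  (psi t)%:E * nu [set x | (f x < t <= F k x)%R].
Proof.
move=> psi0; rewrite /G /=; under eq_integral do rewrite EFinM.
have mB : measurable [set x | (f x < t <= F k x)%R] by exact: measurable_band.
rewrite (_ : (fun x => _) = (fun x => (psi t)%:E *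
   (\1_[set x | (f x < t <= F k x)%R] x)%:E)); last first.
  by apply/funext => x; rewrite !indicE.
rewrite ge0_integralZl_EFin//; last first.
  by apply/measurable_EFinP; exact: measurable_indic.
by rewrite integral_indic// setIT.
Qed.

Lemma le_level_weight (psi : R -> R) k x (c : R) :
  measurable_fun [set: R] psi -> (forall t, 0 <= psi t)%R -> (0 <= c)%R ->
  (forall t, f x < t <= F k x -> psi t <= c)%R ->
  \int[leb]_t G psi k (x, t) <= (c * (F k x - f x))%:E.
Proof.
move=> mpsi psi0 c0 psic; have /andP[fFx _] := fF k x.
have -> : (c * (F k x - f x))%:E =
    \int[leb]_t (c%:E * (\1_(`]f x, F k x]%classic : set R) t)%:E).
  rewrite ge0_integralZl_EFin//; last by apply/measurable_EFinP; exact: measurable_indic.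
  rewrite integral_indic//= setIT lebesgue_measure_itv/= lte_fin.
  move: fFx; rewrite le_eqVlt => /predU1P[->|->]; last by rewrite -EFinB EFinM.
  by rewrite ltxx subrr mulr0 mule0.
apply: ge0_le_integral => //.
- by move=> t _; rewrite lee_fin mulr_ge0.
- exact: (measurableT_comp (measurable_level_weight k mpsi) (pair1_measurable x)).
- apply/measurable_EFinP; exact: measurable_funM.
move=> t _; rewrite lee_fin !indicE.
have [h|h] := boolP ((x, t) \in _).
  have {}h := set_mem h; rewrite mem_set/= ?in_itv//=.
  by rewrite !mulr1 psic.
by rewrite mulr0 mulr_ge0.
Qed.

Lemma measurable_level_flux k : measurable_fun [set: R] (level_flux nu f F k).
Proof.
apply: emeasurable_funM => //.
have := measurable_fun_ysection nu (measurable_level_band mf (mF k)).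
congr measurable_fun; apply/funext => t /=.
by congr (nu _); apply/seteqP; split=> x /=; rewrite ysectionE /=.
Qed.

(** The band from [f x] to [F k x] shrinks to the point [f x], where [psi] is continuous, and
    [k + 1] times its length has limsup [quotient_sup f F x]. *)
Lemma limn_esup_level_weight_le (psi : R -> R) (B : R) x : continuous psi ->
  (forall t, 0 <= psi t <= B)%R ->
  limn_esup (fun k => k.+1%:R%:E * \int[leb]_t G psi k (x, t)) <=
  (psi (f x))%:E * quotient_sup f F x.
Proof.
move=> cpsi psiB.
have psi0 t : (0 <= psi t)%R by case/andP: (psiB t).
have B0 : (0 <= B)%R by case/andP: (psiB 0%R); exact: le_trans.
have mpsi : measurable_fun [set: R] psi by exact: continuous_measurable_fun.
have /andP[q0 q1] := quotient_sup_ge0_le1 x.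
have qfin : quotient_sup f F x \is a fin_num.
  by rewrite ge0_fin_numE// (le_lt_trans q1)// ltry.
have qE := fineK qfin; set U := fine _ in qE; rewrite -qE.
rewrite -qE !lee_fin in q0 q1.
apply/lee_addgt0Pr => e e0.
(* Since [psi (f x) <= B], [U <= 1] and [dl <= 1], replacing [psi (f x) * U] by
   [(psi (f x) + dl) * (U + dl)] costs at most [dl * (B + 2) <= e]. *)
pose dl := Num.min 1%R (e / (B + 2))%R.
have dl0 : (0 < dl)%R by rewrite lt_min ltr01 divr_gt0//; lra.
have dl1 : (dl <= 1)%R by rewrite ge_min lexx.
have dle : (dl * (B + 2) <= e)%R.
  by rewrite -ler_pdivlMr ?ge_min ?lexx ?orbT//; lra.
apply: limn_esup_le_near.
have /limn_esup_lt_near nu1 : quotient_sup f F x < (U + dl)%:E.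
  by rewrite -qE lte_fin ltrDl.
have [eta /= eta0 Heta] : exists2 eta : R, (0 < eta)%R &
    forall t, (`|f x - t| < eta -> psi t < psi (f x) + dl)%R.
  have := cvgr_lt _ (cpsi (f x)) (psi (f x) + dl)%R.
  rewrite ltrDl => /(_ _ dl0) [eta /= eta0 H].
  by exists eta => // t /H.
near=> k.
have uk : (k.+1%:R * (F k x - f x) < U + dl)%R.
  by rewrite -lte_fin; near: k.
have keta : (k.+1%:R^-1 < eta)%R.
  by near: k; exact: near_infty_natSinv_lt (PosNum eta0).
apply: (@le_trans _ _ (k.+1%:R%:E * ((psi (f x) + dl) * (F k x - f x))%:E)).
  rewrite lee_pmul2l//; apply: le_level_weight => //.
    by rewrite addr_ge0// ltW.
  move=> t /andP[ft tF]; apply/ltW/Heta.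
  have /andP[_ FK] := fF k x.
  rewrite distrC ger0_norm ?subr_ge0 ?ltW//.
  by rewrite ltrBlDl (le_lt_trans tF)// (le_lt_trans FK)// ltrD2l.
rewrite -!EFinM -EFinD lee_fin.
have /andP[u0 u1] := quotient_ge0_le1 k x.
have := psiB (f x) => /andP[p0 pB].
rewrite mulrCA.
apply: (@le_trans _ _ ((psi (f x) + dl) * (U + dl))%R).
  by rewrite ler_wpM2l ?addr_ge0// ltW.
nra.
Unshelve. all: by end_near. Qed.

Lemma coarea_le (psi : R -> R) (B : R) : continuous psi ->
  (forall t, 0 <= psi t <= B)%R ->
  \int[leb]_t ((psi t)%:E * limn_einf (fun k => level_flux nu f F k t)) <=
  \int[nu]_x ((psi (f x))%:E * quotient_sup f F x).
Proof.
move=> cpsi psiB.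
have psi0 t : (0 <= psi t)%R by case/andP: (psiB t).
have mpsi : measurable_fun [set: R] psi by exact: continuous_measurable_fun.
have G0 k z : 0 <= G psi k z by rewrite lee_fin mulr_ge0.
have psiE0 t : 0 <= (psi t)%:E by rewrite lee_fin.
have mG k : measurable_fun [set: TR] (G psi k) by exact: measurable_level_weight.
have flux0 k t : 0 <= level_flux nu f F k t by rewrite mule_ge0.
have iG0 k x : 0 <= \int[leb]_t G psi k (x, t) by exact: integral_ge0.
have miG k : measurable_fun [set: T] (fun x => \int[leb]_t G psi k (x, t)).
  exact: (measurable_fun_fubini_tonelli_F (m2 := leb) (G psi k)).
have mpflux k : measurable_fun [set: R] (fun t => (psi t)%:E * level_flux nu f F k t).
  by apply: emeasurable_funM; [exact/measurable_EFinP|exact: measurable_level_flux].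
have fluxE k : \int[leb]_t ((psi t)%:E * level_flux nu f F k t) =
    \int[nu]_x (k.+1%:R%:E * \int[leb]_t G psi k (x, t)).
  rewrite ge0_integralZl_EFin//.
  rewrite (fubini_tonelli (m1 := nu) (m2 := leb) (G psi k))//.
  rewrite -ge0_integralZl_EFin//; last 2 first.
  - by move=> t _; exact: integral_ge0.
  - exact: (measurable_fun_fubini_tonelli_G (m1 := nu) (G psi k)).
  by apply: eq_integral => t _; rewrite level_weightE// muleCA.
apply: (@le_trans _ _ (\int[leb]_t limn_einf (fun k =>
    (psi t)%:E * level_flux nu f F k t))).
  apply: ge0_le_integral => //.
  - move=> t _; rewrite mule_ge0//.
    by apply: limn_einf_ge_near; apply: nearW.
  - apply: emeasurable_funM; first exact/measurable_EFinP.
    exact: measurable_limn_einf (@measurable_level_flux).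
  - exact: measurable_limn_einf mpflux.
  by move=> t _; exact: limn_einf_leZl.
apply: (le_trans (fatou _ _ _ _)) => //.
  by move=> k t _; rewrite mule_ge0.
under eq_fun do rewrite fluxE.
apply: (le_trans (limn_einf_sup _)).
apply: (le_trans (@reverse_fatou _ _ _ nu
  (fun k x => k.+1%:R%:E * \int[leb]_t G psi k (x, t)) B _ _)).
- by move=> k; exact: emeasurable_funM.
(* [B] dominates every term: the weight is at most [B] and the band has length at most
   [1 / (k + 1)]. *)
- move=> k x; rewrite mule_ge0//=.
  have B0 : (0 <= B)%R by case/andP: (psiB 0%R); exact: le_trans.
  have /andP[u0 u1] := quotient_ge0_le1 k x.
  apply: (@le_trans _ _ (k.+1%:R%:E * (B * (F k x - f x))%:E)).
    rewrite lee_pmul2l//; apply: le_level_weight => // t _.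
    by case/andP: (psiB t).
  by rewrite -EFinM lee_fin mulrCA ler_piMr.
apply: ge0_le_integral => //.
- move=> x _; apply: le_trans (limn_einf_sup _).
  by apply: limn_einf_ge_near; apply: nearW => k; rewrite mule_ge0.
- by apply: measurable_fun_limn_esup => k; exact: emeasurable_funM.
- apply: emeasurable_funM; last exact: measurable_quotient_sup.
  by apply/measurable_EFinP; exact: measurableT_comp.
by move=> x _; exact: (limn_esup_level_weight_le _ cpsi psiB).
Qed.

End Coarea.

(** * Power integrals *)

Section PowerIntegrals.
Variable R : realType.
Local Notation leb := (@lebesgue_measure R).

Lemma continuous_powR (s : R) (x : R) : 0 < x -> {for x, continuous (@powR R ^~ s)}.
Proof.
move=> x0; apply/differentiable_continuous/derivable1_diffP.
by apply: derivable_powR; rewrite in_itv/= x0.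
Qed.

Lemma continuous_norm_powR (s : R) : 0 <= s -> continuous (fun t : R => `|t| `^ s).
Proof.
rewrite le_eqVlt => /predU1P[<-|s0] x.
  by under eq_fun do rewrite powRr0; exact: cvg_cst.
have [->|x0] := eqVneq x 0.
  apply/cvgrPdist_lt => e e0.
  near=> t; rewrite normr0 powR0 ?gt_eqF// sub0r normrN ger0_norm ?powR_ge0//.
  have -> : e = (e `^ s^-1) `^ s by rewrite -powRrM mulVf ?gt_eqF// powRr1// ltW.
  apply: gt0_ltr_powR => //; rewrite ?nnegrE ?powR_ge0//.
  near: t; exists (e `^ s^-1) => /=; first exact: powR_gt0.
  by move=> z /=; rewrite sub0r normrN.
apply: (@continuous_comp _ _ _ (fun t : R => `|t|) (@powR R ^~ s)).
  exact: norm_continuous.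
by apply: continuous_powR; rewrite normr_gt0.
Unshelve. all: by end_near. Qed.

Variables (be : R) (h H : R -> R).
Hypothesis be1 : 1 <= be.
Hypothesis ch : forall u : R, 0 <= u -> {for u, continuous h}.
Hypothesis dH : forall u : R, 0 <= u -> is_derive u 1 H (h u).
Let be0 : 0 < be. Proof. exact: lt_le_trans be1. Qed.
(** For [t > 0] this is the derivative of [H] composed with the power [be] of [t], and it is even in
    [t]. The choice [h = 1] yields the layer cake formula, a negative power the error integral. *)
Let w (t : R) : R := be * `|t| `^ (be - 1) * h (`|t| `^ be).

Lemma continuous_power_weight : continuous w.
Proof.
move=> x; apply: cvgM.
  apply: cvgM; first exact: cvg_cst.
  by apply: continuous_norm_powR; rewrite subr_ge0.
apply: (@continuous_comp _ _ _ (fun t : R => `|t| `^ be) h).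
  by apply: continuous_norm_powR; rewrite (le_trans ler01).
exact/ch/powR_ge0.
Qed.

Lemma integral_power_weight y : 0 <= y ->
  (\int[leb]_(t in `[0%R, y]) (w t)%:E = (H (y `^ be) - H 0)%:E)%E.
Proof.
rewrite le_eqVlt => /predU1P[<-|y0].
  by rewrite set_itv1 integral_set1 powR0 ?subrr// gt_eqF.
have -> : H (y `^ be) - H 0 = H (`|y| `^ be) - H (`|0 : R| `^ be).
  by rewrite gtr0_norm// normr0 powR0// gt_eqF.
rewrite EFinB.
have cF : continuous (fun t : R => H (`|t| `^ be)).
  move=> x; apply: (@continuous_comp _ _ _ (fun t : R => `|t| `^ be) H).
    by apply: continuous_norm_powR; rewrite (le_trans ler01).
  apply/differentiable_continuous/derivable1_diffP.
  by have [] := dH (powR_ge0 `|x| be).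
have dF (x : R) : 0 < x -> is_derive x 1 (fun t : R => H (`|t| `^ be)) (w x).
  move=> x0.
  have wE : w x = h (x `^ be) * (be * x `^ (be - 1)).
    by rewrite /w gtr0_norm// mulrC.
  rewrite wE.
  apply: (@near_eq_is_derive _ _ _ (H \o (@powR R ^~ be))) => //.
    by near=> t => /=; rewrite gtr0_norm//; near: t; exact: lt_nbhsr.
  by apply: is_derive1_comp; [exact: dH (powR_ge0 _ _)|exact: is_derive1_powR].
(* Differentiability is asked only on the open interval, so the kink of the absolute value at [0] is
   harmless. *)
apply: (@continuous_FTC2 R w (fun t : R => H (`|t| `^ be))) => //.
- by apply: continuous_subspaceT => x; exact: continuous_power_weight.
- split.
  + by move=> x; rewrite in_itv/= => /andP[x0 _]; have [] := dF _ x0.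
  + by apply: cvg_at_right_filter; exact: cF.
  + by apply: cvg_at_left_filter; exact: cF.
- move=> x; rewrite in_itv/= => /andP[x0 _].
  by have [_ <-] := dF _ x0; rewrite derive1E.
Unshelve. all: by end_near. Qed.

Lemma integral_power_weightN y : 0 <= y ->
  (\int[leb]_(t in `[(- y)%R, 0%R]) (w t)%:E = (H (y `^ be) - H 0)%:E)%E.
Proof.
move=> y0; rewrite -[X in `[_, X]]oppr0 integration_by_substitution_oppr//.
  rewrite -integral_power_weight//; apply: eq_integral => t _ /=.
  by rewrite /w normrN.
by apply: continuous_subspaceT => x; exact: continuous_power_weight.
Qed.

End PowerIntegrals.

(** * Young's inequality and its error term *)

Section Young.
Variable R : realType.

(** Young's inequality with the conjugate exponents [al^-1] and [p + 1]; the factors are scaled by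
    [k * v / al] so that the first term is exactly [k * v * g]. *)
Lemma young_powR (al p k c v g : R) : 0 < al < 1 -> p * (1 - al) = al ->
  0 < k -> 0 <= c -> 0 < v -> 0 <= g ->
  c * g `^ al <= k * v * g
    + (p + 1)^-1 * c `^ (p + 1) * (al / (k * v)) `^ p.
Proof.
move=> /andP[al0 al1] pal k0 c0 v0 g0.
have p0 : 0 < p by nra.
have alE : al = p / (p + 1) by apply: (canRL (mulfK _)); lra.
have kv0 : 0 < k * v by rewrite mulr_gt0.
have := @conjugate_powR R ((k * v * g / al) `^ al) (c * (al / (k * v)) `^ al)
  al^-1 (p + 1).
rewrite !powR_ge0 mulr_ge0 ?powR_ge0// => /(_ isT isT).
rewrite invr_gt0 al0 ltr_wpDr// => /(_ isT isT).
have -> : al^-1^-1 + (p + 1)^-1 = 1 by rewrite invrK alE; field; lra.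
move=> /(_ erefl).
rewrite -powRrM mulfV ?gt_eqF// powRr1; last first.
  by rewrite divr_ge0 ?mulr_ge0// ltW.
rewrite invrK divfK ?gt_eqF// [(c * _) `^ _]powRM ?powR_ge0// -powRrM.
have -> : al * (p + 1) = p by rewrite alE; field; lra.
have -> : (k * v * g / al) `^ al * (c * (al / (k * v)) `^ al) = c * g `^ al.
  rewrite mulrCA -powRM; try by rewrite ?divr_ge0 ?mulr_ge0// ltW.
  by congr (_ * _ `^ _); field; lra.
lra.
Qed.

(** Bounding the power of [|t|] by the same power of [(|t|^be + r)^(1/be)] leaves the error as the
    derivative of [|t|^be] times a power of [|t|^be + r], which integrates explicitly. *)
Lemma young_error_le (al be p k I r t : R) : 0 < al < 1 -> 1 <= be ->
  p * (1 - al) = al -> 0 < k -> 0 < I -> 0 < r ->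
  (p + 1)^-1 * (be * `|t| `^ (be - 1) * I) `^ (p + 1)
     * (al / (k * (`|t| `^ be + r))) `^ p <=
  I `^ (p + 1) * (al / k) `^ p * be `^ p / (p + 1)
     * (be * `|t| `^ (be - 1) * (`|t| `^ be + r) `^ (- (p / be))).
Proof.
move=> /andP[al0 al1] be1 pal k0 I0 r0.
have p0 : 0 < p by nra.
have be0 : 0 < be by lra.
have v0 : 0 < `|t| `^ be + r by rewrite ltr_wpDl ?powR_ge0.
set v := _ + r in v0 *.
set s := `|t|.
have s0 : 0 <= s by exact: normr_ge0.
have -> : (be * s `^ (be - 1) * I) `^ (p + 1) =
    be `^ p * s `^ ((be - 1) * p) * (be * s `^ (be - 1)) * I `^ (p + 1).
  rewrite powRM ?mulr_ge0 ?powR_ge0// ?(ltW be0)// ?(ltW I0)//.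
  congr (_ * _).
  rewrite powRD; last by rewrite gt_eqF//; lra.
  rewrite powRr1 ?mulr_ge0 ?powR_ge0// ?(ltW be0)//.
  by rewrite powRM ?powR_ge0 ?(ltW be0)// -powRrM.
have -> : (al / (k * v)) `^ p = (al / k) `^ p * v `^ (- p).
  rewrite invfM mulrA powRM ?divr_ge0 ?invr_ge0 ?(ltW v0) ?(ltW k0) ?(ltW al0)//.
  by rewrite -[v^-1]powR_inv1 ?(ltW v0)// -powRrM mulN1r.
have sv : s `^ ((be - 1) * p) * v `^ (- p) <= v `^ (- (p / be)).
  have -> : (be - 1) * p = be * ((be - 1) * p / be) by field; lra.
  rewrite powRrM.
  have -> : - (p / be) = (be - 1) * p / be + - p by field; lra.
  rewrite powRD; last by rewrite (lt0r_neq0 v0) implybT.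
  rewrite ler_wpM2r ?powR_ge0// ge0_ler_powR ?nnegrE ?powR_ge0//.
  - by rewrite divr_ge0 ?mulr_ge0//; lra.
  - exact: ltW.
  - by rewrite lerDl ltW.
rewrite [leLHS](_ : _ = (s `^ ((be - 1) * p) * v `^ (- p)) *
   ((p + 1)^-1 * be `^ p * (be * s `^ (be - 1)) * I `^ (p + 1)
     * (al / k) `^ p)); last ring.
rewrite [leRHS](_ : _ = v `^ (- (p / be)) *
   ((p + 1)^-1 * be `^ p * (be * s `^ (be - 1)) * I `^ (p + 1)
     * (al / k) `^ p)); last ring.
rewrite ler_wpM2r// !mulr_ge0 ?powR_ge0 ?invr_ge0//; lra.
Qed.

End Young.

(** * Layer cake formula and the error integral *)

Section LayerCake.
Variable R : realType.
Local Notation leb := (@lebesgue_measure R).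

(** The levels between [0] and [y], with ends chosen so that membership of [t] says [t <= y] for
    [t > 0] and [y < t] for [t < 0]: these are the upper and lower tails around the median. The
    level [0] is never included. *)
Definition layer (y : R) : set R := [set t | (0 < t <= y) || (y < t < 0)].

Lemma layer_ge0 (y : R) : 0 <= y -> layer y = `]0%R, y]%classic.
Proof.
move=> y0; apply/seteqP; split=> t; rewrite /layer /= in_itv /=.
  by case/orP => // /andP[yt t0]; have := lt_trans (le_lt_trans y0 yt) t0; rewrite ltxx.
by move=> ->.
Qed.

Lemma layer_le0 (y : R) : y <= 0 -> layer y = `]y, 0%R[%classic.
Proof.
move=> y0; apply/seteqP; split=> t; rewrite /layer /= in_itv /=.
  by case/orP => // /andP[t0 ty]; have := lt_le_trans t0 (le_trans ty y0); rewrite ltxx.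
by move=> ->; rewrite orbT.
Qed.

Lemma integral_layer (be y : R) : 1 <= be ->
  (\int[leb]_t ((be * `|t| `^ (be - 1)) * \1_(layer y) t)%:E = (`|y| `^ be)%:E)%E.
Proof.
move=> be1.
have c1 (u : R) : 0 <= u -> {for u, continuous (fun=> 1 : R)}.
  by move=> _; exact: cvg_cst.
have d1 (u : R) : 0 <= u -> is_derive u 1 id (1 : R) by move=> _; exact: is_derive_id.
have cw := continuous_power_weight be1 c1.
have mw : measurable_fun [set: R] (fun t : R => be * `|t| `^ (be - 1) * 1).
  exact: continuous_measurable_fun.
have E A : measurable A ->
    (\int[leb]_t ((be * `|t| `^ (be - 1)) * \1_A t)%:E =
    \int[leb]_(t in A) (be * `|t| `^ (be - 1) * 1)%:E)%E.
  move=> mA; rewrite [RHS]integral_mkcond; apply: eq_integral => t _.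
  rewrite patchE indicE; case: ifPn => _; first by rewrite !mulr1.
  by rewrite mulr0.
have [y0|/ltW y0] := leP 0 y.
  rewrite layer_ge0// E// integral_itv_obnd_cbnd; last first.
    by apply/measurable_EFinP/measurable_funTS.
  by rewrite (integral_power_weight be1 c1 d1)// ger0_norm// subr0.
rewrite layer_le0// E// integral_itv_bndo_bndc; last first.
  by apply/measurable_EFinP/measurable_funTS.
rewrite integral_itv_obnd_cbnd; last first.
  by apply/measurable_EFinP/measurable_funTS.
have := integral_power_weightN be1 c1 d1 (y := - y).
by rewrite oppr_ge0 opprK => ->//; rewrite ler0_norm// subr0.
Qed.

(** The integrand is even, and its primitive on each half is a negative multiple of a power with
    exponent [1 - p / be < 0]. Dropping the contribution at [N] leaves a bound uniform in [N]. *)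
Lemma integral_error_le (be p r N : R) : 1 <= be -> be < p -> 0 < r -> 0 <= N ->
  (\int[leb]_(t in `[(- N)%R, N])
      (be * `|t| `^ (be - 1) * (`|t| `^ be + r) `^ (- (p / be)))%:E <=
   (2 * (be / (p - be) * r `^ (1 - p / be)))%:E)%E.
Proof.
move=> be1 bep r0 N0.
have be0 : 0 < be by lra.
pose h (u : R) := (u + r) `^ (- (p / be)).
pose H (u : R) := (1 - p / be)^-1 * (u + r) `^ (1 - p / be).
have g1 : 1 < p / be by rewrite ltr_pdivlMr// mul1r.
have ur (u : R) : 0 <= u -> 0 < u + r by move=> u0; rewrite ltr_wpDl.
have ch (u : R) : 0 <= u -> {for u, continuous h}.
  move=> u0; apply: (@continuous_comp _ _ _ (fun u : R => u + r) (@powR R ^~ _)).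
    by apply: cvgD; [exact: cvg_id|exact: cvg_cst].
  by apply: continuous_powR; exact: ur.
have dH (u : R) : 0 <= u -> is_derive u 1 H (h u).
  move=> u0.
  have -> : h u = (1 - p / be)^-1 *:
      ((1 - p / be) * (u + r) `^ (1 - p / be - 1) * (1 + 0)).
    rewrite /h addr0 mulr1 -[RHS]/(_ * (_ * _)) mulKf; last lra.
    by congr powR; ring.
  apply: is_deriveZ.
  apply: (@is_derive1_comp R (@powR R ^~ (1 - p / be)) (fun u : R => u + r)).
    by apply: is_derive1_powR; exact: ur.
have cw := continuous_power_weight be1 ch.
have mw D : measurable_fun D (fun t : R => be * `|t| `^ (be - 1) * h (`|t| `^ be)).
  by apply: measurable_funTS; exact: continuous_measurable_fun.
have -> : `[(- N)%R, N]%classic = `[(- N)%R, 0%R[%classic `|` `[0%R, N]%classic.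
  by rewrite -itv_bndbnd_setU// bnd_simp oppr_le0.
rewrite ge0_integral_setU//=; last 3 first.
- apply/measurable_EFinP. exact: mw.
- by move=> t _; rewrite lee_fin !mulr_ge0 ?powR_ge0// ltW.
- apply/disj_setPS => t [] /=; rewrite !in_itv/= => /andP[_ t0] /andP[t1 _].
  by have := lt_le_trans t0 t1; rewrite ltxx.
rewrite integral_itv_bndo_bndc; last by apply/measurable_EFinP; exact: mw.
rewrite (integral_power_weightN be1 ch dH)// (integral_power_weight be1 ch dH)//.
rewrite -EFinD lee_fin.
suff : H (N `^ be) - H 0 <= be / (p - be) * r `^ (1 - p / be) by lra.
rewrite /H add0r.
have : 0 <= (p / be - 1)^-1 * (N `^ be + r) `^ (1 - p / be).
  by rewrite mulr_ge0 ?powR_ge0// invr_ge0; lra.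
have -> : (1 - p / be)^-1 = - (p / be - 1)^-1 by rewrite -invrN opprB.
have -> : be / (p - be) = (p / be - 1)^-1 by field; lra.
lra.
Qed.

End LayerCake.

(** * The absorption argument *)

Section TruncatedMoment.
Context d (T : measurableType d) (R : realType) (nu : probability T R).
Variables (f : T -> R) (F : (T -> R)^nat).
Hypotheses (mf : measurable_fun [set: T] f)
  (mF : forall k, measurable_fun [set: T] (F k))
  (fF : forall k x, f x <= F k x <= f x + k.+1%:R^-1).
Variables al be p I : R.
Hypotheses (al01 : 0 < al < 1) (be1 : 1 <= be) (pal : p * (1 - al) = al)
  (bep : be < p) (I0 : 0 < I).
Local Notation leb := (@lebesgue_measure R).
Local Notation TR := (T * measurableTypeR R)%type.
Let g (t : R) : \bar R := limn_einf (fun k => level_flux nu f F k t).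
Let tail (t : R) : set T :=
  if 0 < t then [set x | t <= f x] else [set x | f x < t].
Hypothesis iso : forall t, t != 0 -> (nu (tail t) <= I%:E * g t `^ al)%E.

(** Two-sided truncation: the moment becomes finite, hence absorbable, and only levels in [[-N, N]]
    contribute. *)
Definition clamp (N y : R) : R := Num.max (- N) (Num.min y N).

Variables (N r : R).
Hypotheses (N0 : 0 <= N) (r0 : 0 < r).

Lemma normr_clamp_le y : `|clamp N y| <= N.
Proof.
rewrite ler_norml le_max lexx /= ge_max ge_min lexx orbT andbT.
by rewrite (le_trans _ N0) ?oppr_le0.
Qed.

Lemma clamp_id t : - N <= t <= N -> clamp N t = t.
Proof.
by move=> /andP[h1 h2]; rewrite /clamp; move/min_idPl : (h2) => ->; exact/max_idPr.
Qed.

Lemma continuous_clamp : continuous (clamp N).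
Proof.
move=> x; apply: (@continuous_max R R (fun=> - N) (fun y => Num.min y N)).
  exact: cvg_cst.
by apply: (@continuous_min R R id (fun=> N)); [exact: cvg_id|exact: cvg_cst].
Qed.

Lemma layer_clamp_out y t : ~~ (- N <= t <= N) -> ~ layer (clamp N y) t.
Proof.
move=> /negP tN /orP[] /andP[h1 h2]; apply: tN.
  have := normr_clamp_le y; rewrite ler_norml => /andP[_ h].
  by rewrite (le_trans h2 h) andbT (le_trans _ (ltW h1))// oppr_le0.
have := normr_clamp_le y; rewrite ler_norml => /andP[h _].
by rewrite (le_trans h (ltW h1))/= (le_trans (ltW h2)).
Qed.

(** Truncation moves values only towards [0], so it adds no point to a tail. *)
Lemma layer_clamp_sub t : t != 0 ->
  [set x | layer (clamp N (f x)) t] `<=` tail t.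
Proof.
move=> t0 x; rewrite /tail /layer /= /clamp.
have [t_gt0|t_le0] := ltP 0 t.
  rewrite [t < 0]ltNge (ltW t_gt0) andbF orbF /= le_max le_min.
  move=> /orP[tN|/andP[]//].
  by have := lt_le_trans t_gt0 tN; rewrite oppr_gt0 ltNge N0.
rewrite /= gt_max gt_min => /andP[/andP[_ /orP[//|Nt]] _].
by have := lt_le_trans Nt t_le0; rewrite ltNge N0.
Qed.

Lemma truncated_moment_le :
  let S := fine (\int[nu]_x (`|clamp N (f x)| `^ be)%:E) in
  let D := fine (\int[nu]_x quotient_sup f F x) in
  al / be * S <= (1 - al / be) * r * D
    + 2 * (I `^ (p + 1) * (al / (1 - al / be)) `^ p * be `^ (p + 1)
           / ((p + 1) * (p - be))) * r `^ (1 - p / be).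
Proof.
have [al0 al1] := andP al01.
have be0 : 0 < be by exact: lt_le_trans be1.
have p0 : 0 < p by exact: lt_trans bep.
(* Young's parameter: the share [k] of the moment is absorbed and [al / be] of it survives. *)
set k := 1 - al / be.
have k0 : 0 < k by rewrite subr_gt0 ltr_pdivrMr// mul1r; exact: lt_le_trans be1.
(* Clamping keeps [psi] bounded, as [coarea_le] requires, and [r] keeps it positive, as Young's
   inequality requires. *)
pose psi (t : R) := `|clamp N t| `^ be + r.
pose err (t : R) := be * `|t| `^ (be - 1) * (`|t| `^ be + r) `^ (- (p / be)).
pose A := I `^ (p + 1) * (al / k) `^ p * be `^ p / (p + 1).
have A0 : 0 <= A by rewrite !mulr_ge0 ?powR_ge0 ?invr_ge0 ?addr_ge0// ltW.
have g0 t : (0 <= g t)%E.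
  by apply: limn_einf_ge_near; apply: nearW => j; rewrite mule_ge0.
have cpsi : continuous psi.
  move=> x; apply: cvgD; last exact: cvg_cst.
  apply: (@continuous_comp _ _ _ (clamp N) (fun t => `|t| `^ be)).
    exact: continuous_clamp.
  by apply: continuous_norm_powR; exact: ltW.
have qs01 x := quotient_sup_ge0_le1 fF x.
have psi_gt0 t : 0 < psi t by rewrite ltr_wpDl ?powR_ge0.
have psiB t : 0 <= psi t <= N `^ be + r.
  rewrite (ltW (psi_gt0 t)) lerD2r ge0_ler_powR ?nnegrE ?(ltW be0)//.
  exact: normr_clamp_le.
have mclamp : measurable_fun [set: R] (clamp N).
  exact: continuous_measurable_fun continuous_clamp.
have mpsi : measurable_fun [set: R] psi by exact: continuous_measurable_fun.
have mpow : measurable_fun [set: R] (fun y => `|clamp N y| `^ be).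
  apply: continuous_measurable_fun => x.
  apply: (@continuous_comp _ _ _ (clamp N) (fun t => `|t| `^ be)).
    exact: continuous_clamp.
  by apply: continuous_norm_powR; exact: ltW.
have mg : measurable_fun [set: R] g.
  by apply: measurable_limn_einf => j; exact: measurable_level_flux.
have merr : measurable_fun [set: R] err.
  apply: continuous_measurable_fun.
  apply: (continuous_power_weight be1 (h := fun u => (u + r) `^ (- (p / be)))) => u u0.
  apply: (@continuous_comp _ _ _ (fun u : R => u + r) (@powR R ^~ _)).
    by apply: cvgD; [exact: cvg_id|exact: cvg_cst].
  by apply: continuous_powR; rewrite ltr_wpDl.
have w0 t : 0 <= be * `|t| `^ (be - 1) by rewrite mulr_ge0 ?powR_ge0// ltW.
have mw : measurable_fun [set: R] (fun t : R => be * `|t| `^ (be - 1)).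
  apply: continuous_measurable_fun => x.
  apply: cvgM; first exact: cvg_cst.
  by apply: continuous_norm_powR; rewrite subr_ge0.
have err0 t : 0 <= err t by rewrite mulr_ge0 ?powR_ge0.
pose L := [set z : TR | layer (clamp N (f z.1)) z.2].
have mL : measurable L.
  have mcf : measurable_fun [set: TR] (fun z : TR => clamp N (f z.1)).
    exact: measurableT_comp mclamp (measurableT_comp mf measurable_fst).
  have m2 : measurable_fun [set: TR] (fun z : TR => z.2 : R) by exact: measurable_snd.
  have mb : measurable_fun [set: TR] (fun z : TR =>
      (0 < z.2 <= clamp N (f z.1)) || (clamp N (f z.1) < z.2 < 0)).
    apply: measurable_or; apply: measurable_and;
      by [exact: measurable_fun_ltr|exact: measurable_fun_ler].
  rewrite [X in measurable X](_ : _ = [set: TR] `&` (fun z : TR =>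
      (0 < z.2 <= clamp N (f z.1)) || (clamp N (f z.1) < z.2 < 0)) @^-1` [set true]).
    exact: mb.
  by rewrite setTI; apply/seteqP; split.
have mLt t : measurable [set x | layer (clamp N (f x)) t].
  have := measurable_ysection t mL.
  by congr measurable; apply/seteqP; split=> x /=; rewrite ysectionE /=.
have layercake : (\int[nu]_x (`|clamp N (f x)| `^ be)%:E =
    \int[leb]_t ((be * `|t| `^ (be - 1))%:E * nu [set x | layer (clamp N (f x)) t]))%E.
  pose G (z : TR) : \bar R := (be * `|z.2| `^ (be - 1) * \1_L z)%:E.
  have mG : measurable_fun [set: TR] G.
    apply/measurable_EFinP; apply: measurable_funM; last exact: measurable_indic.
    exact: (measurableT_comp mw measurable_snd).
  have G0 z : (0 <= G z)%E by rewrite lee_fin mulr_ge0.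
  transitivity (\int[nu]_x \int[leb]_t G (x, t))%E.
    apply: eq_integral => x _; rewrite -integral_layer//.
  rewrite (fubini_tonelli (m1 := nu) (m2 := leb) G)//.
  apply: eq_integral => t _; rewrite /G /=.
  under eq_integral do rewrite EFinM.
  rewrite (_ : (fun x => _) = (fun x => (be * `|t| `^ (be - 1))%:E *
     (\1_[set x | layer (clamp N (f x)) t] x)%:E)%E); last first.
    by apply/funext => x; rewrite !indicE.
  rewrite ge0_integralZl_EFin//; last by apply/measurable_EFinP; exact: measurable_indic.
  by rewrite integral_indic// setIT.
have pointwise t : ((be * `|t| `^ (be - 1))%:E * nu [set x | layer (clamp N (f x)) t] <=
    k%:E * ((psi t)%:E * g t) + A%:E * (err t * \1_(`[- N, N]%classic) t)%:E)%E.
  have rhs0 : (0 <= k%:E * ((psi t)%:E * g t) +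
      A%:E * (err t * \1_(`[- N, N]%classic) t)%:E)%E.
    apply: adde_ge0; apply: mule_ge0; rewrite ?lee_fin ?(ltW k0)//.
      by rewrite mule_ge0 ?lee_fin ?(ltW (psi_gt0 t)).
    by rewrite mulr_ge0.
  (* At [t = 0] and outside [[-N, N]] the layer is empty; elsewhere [iso] applies. *)
  have [/andP[tN t0]|tN] := boolP ((- N <= t <= N) && (t != 0)); last first.
    rewrite (_ : [set x | _] = set0) ?measure0 ?mule0//.
    apply/seteqP; split=> x //=.
    have [tI|] := boolP (- N <= t <= N); last exact: layer_clamp_out.
    move: tN; rewrite tI /= negbK => /eqP ->.
    by rewrite /layer /= ltxx /= andbF.
  have mtail : measurable (tail t).
    have mle : measurable [set x | t <= f x].
      by rewrite -[X in measurable X]setTI; apply: measurable_fun_le.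
    rewrite /tail; case: ifP => // _.
    rewrite (_ : [set x | f x < t] = ~` [set x | t <= f x]); first exact: measurableC.
    by apply/seteqP; split=> x /=; rewrite ltNge => /negP.
  have nug : (nu [set x | layer (clamp N (f x)) t] <= I%:E * g t `^ al)%E.
    apply: le_trans (iso t0); apply: le_measure; rewrite ?inE//.
    exact: layer_clamp_sub.
  apply: (@le_trans _ _ ((be * `|t| `^ (be - 1))%:E * (I%:E * g t `^ al))%E).
    by apply: lee_wpmul2l => //; rewrite lee_fin.
  have psiE : psi t = `|t| `^ be + r by rewrite /psi clamp_id.
  (* If [g t] is infinite, so is the right-hand side, because [k] and [psi t] are positive. *)
  case: (g t) (g0 t) rhs0 => [gt|_ _|//]; last first.
    by rewrite !gt0_muley ?lte_fin// leey.
  rewrite lee_fin => gt0 _.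
  rewrite poweR_EFin -!EFinM -EFinD lee_fin mulrA.
  have c0 : 0 <= be * `|t| `^ (be - 1) * I by rewrite mulr_ge0// ltW.
  apply: (le_trans (young_powR al01 pal k0 c0 (psi_gt0 t) gt0)).
  rewrite mulrA lerD2l indicE mem_set//= ?mulr1 ?in_itv//=.
  by rewrite psiE; exact: young_error_le.
have coarea : (\int[leb]_t ((psi t)%:E * g t) <=
   \int[nu]_x (`|clamp N (f x)| `^ be)%:E + r%:E * \int[nu]_x quotient_sup f F x)%E.
  apply: (le_trans (coarea_le nu mf mF fF cpsi psiB)).
  rewrite -(ge0_integralZl_EFin nu measurableT _
      (measurable_quotient_sup mf mF) (ltW r0));
    last by move=> x _; case/andP: (qs01 x).
  rewrite -ge0_integralD//=; last 3 first.
  - by apply/measurable_EFinP; exact: measurableT_comp mpow mf.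
  - by move=> x _; rewrite mule_ge0 ?lee_fin ?(ltW r0)//; case/andP: (qs01 x).
  - by apply: emeasurable_funM => //; exact: measurable_quotient_sup.
  apply: ge0_le_integral => //.
  - move=> x _; rewrite mule_ge0 ?lee_fin ?(ltW (psi_gt0 _))//.
    by case/andP: (qs01 x).
  - apply: emeasurable_funM; last exact: measurable_quotient_sup.
    by apply/measurable_EFinP; exact: measurableT_comp mpsi mf.
  - apply: emeasurable_funD.
      by apply/measurable_EFinP; exact: measurableT_comp mpow mf.
    by apply: emeasurable_funM => //; exact: measurable_quotient_sup.
  (* As the slope is at most [1], the unclamped-by-[r] part of [psi] returns at most the truncated
     moment, which is what gets absorbed. *)
  move=> x _; have /andP[] := qs01 x.
  case: (quotient_sup f F x) => // q; rewrite !lee_fin => q0 q1.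
  by rewrite /psi mulrDl lerD2r ler_piMr ?powR_ge0.
have Sfin : (\int[nu]_x (`|clamp N (f x)| `^ be)%:E \is a fin_num)%E.
  suff h x : (0 <= (`|clamp N (f x)| `^ be)%:E <= (N `^ be)%:E)%E.
    by have [] := integral_bounded nu h.
  rewrite !lee_fin powR_ge0 ge0_ler_powR ?nnegrE ?(ltW be0)//.
  exact: normr_clamp_le.
have Dfin : (\int[nu]_x quotient_sup f F x \is a fin_num)%E.
  by have [] := integral_bounded nu (B := 1) qs01.
rewrite /=; set S := fine _; set D := fine _.
have main : (S%:E <= k%:E * (S%:E + r%:E * D%:E) +
    (A * (2 * (be / (p - be) * r `^ (1 - p / be))))%:E)%E.
  rewrite /S /D !fineK// {1}layercake.
  have m1 : measurable_fun [set: R] (fun t => (psi t)%:E * g t)%E.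
    by apply: emeasurable_funM => //; exact/measurable_EFinP.
  have m2 : measurable_fun [set: R] (fun t => (err t * \1_(`[- N, N]%classic) t)%:E).
    by apply/measurable_EFinP; exact: measurable_funM.
  have m0 : measurable_fun [set: R] (fun t => nu [set x | layer (clamp N (f x)) t]).
    have := measurable_fun_ysection nu mL.
    congr measurable_fun; apply/funext => t /=.
    by congr (nu _); apply/seteqP; split=> x /=; rewrite ysectionE /=.
  have e0 t : (0 <= (err t * \1_(`[- N, N]%classic) t)%:E)%E.
    by rewrite lee_fin mulr_ge0.
  have pg0 t : (0 <= (psi t)%:E * g t)%E.
    by rewrite mule_ge0 ?lee_fin ?(ltW (psi_gt0 t)).
  apply: (@le_trans _ _ (\int[leb]_t (k%:E * ((psi t)%:E * g t) +
     A%:E * (err t * \1_(`[- N, N]%classic) t)%:E))%E).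
    apply: ge0_le_integral => //.
    - by move=> t _; apply: mule_ge0 => //; rewrite lee_fin.
    - by apply: emeasurable_funM => //; exact/measurable_EFinP.
    - by apply: emeasurable_funD; exact: emeasurable_funM.
  rewrite ge0_integralD//=; last 4 first.
  - by move=> t _; rewrite mule_ge0 ?lee_fin ?(ltW k0).
  - exact: emeasurable_funM.
  - by move=> t _; apply: mule_ge0; [rewrite lee_fin|exact: e0].
  - exact: emeasurable_funM.
  rewrite !ge0_integralZl_EFin// ?(ltW k0)//.
  apply: leeD; first by rewrite lee_wpmul2l ?lee_fin ?(ltW k0).
  rewrite [leRHS]EFinM lee_wpmul2l ?lee_fin//.
  apply: le_trans (integral_error_le be1 bep r0 N0).
  rewrite [leRHS]integral_mkcond le_eqVlt; apply/orP; left; apply/eqP.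
  apply: eq_integral => t _; rewrite patchE indicE.
  by case: ifPn => _; rewrite ?mulr1 ?mulr0.
rewrite -!EFinM -!EFinD lee_fin in main.
have E1 : 2 * (I `^ (p + 1) * (al / k) `^ p * be `^ (p + 1)
    / ((p + 1) * (p - be))) * r `^ (1 - p / be) =
    A * (2 * (be / (p - be) * r `^ (1 - p / be))).
  rewrite /A (powRD (x := be)); last by rewrite (lt0r_neq0 be0) implybT.
  rewrite powRr1 ?(ltW be0)//; field.
  by rewrite !lt0r_neq0 ?subr_gt0 ?addr_gt0.
have -> : al / be = 1 - k by rewrite /k subKr.
rewrite E1; move: main; lra.
Qed.

End TruncatedMoment.

(** * Euclidean enlargements *)

Section EuclideanNorm.
Variables (R : realType) (n : nat).
Implicit Types x y : 'rV[R]_n.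

Lemma enorm_ge0 x : 0 <= enorm x.
Proof. exact: sqrtr_ge0. Qed.

Lemma enorm0 : enorm (0 : 'rV[R]_n) = 0.
Proof.
by rewrite /enorm big1 ?sqrtr0// => i _; rewrite mxE expr0n.
Qed.

Lemma enormZ (s : R) x : 0 <= s -> enorm (s *: x) = s * enorm x.
Proof.
move=> s0; rewrite /enorm; under eq_bigr do rewrite mxE exprMn.
by rewrite -mulr_sumr sqrtrM ?sqr_ge0// sqrtr_sqr ger0_norm.
Qed.

Lemma enorm_distC x y : enorm (x - y) = enorm (y - x).
Proof.
by rewrite /enorm; congr Num.sqrt; apply: eq_bigr => i _; rewrite !mxE; ring.
Qed.

Lemma coord_le_enorm x (i : 'I_n) : `|x ord0 i| <= enorm x.
Proof.
rewrite -sqrtr_sqr ler_sqrt; last by apply: sumr_ge0 => j _; exact: sqr_ge0.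
rewrite (bigD1 i)//= lerDl; apply: sumr_ge0 => j _; exact: sqr_ge0.
Qed.

Lemma continuous_enorm : continuous (@enorm R n).
Proof.
move=> x; apply: (@continuous_comp _ _ _
  (fun x : 'rV[R]_n => \sum_(i < n) x ord0 i ^+ 2) Num.sqrt).
  apply: (@continuous_big R _ +%R 0 xpredT add_continuous) => i _ y.
  apply: (@continuous_comp _ _ _ (fun x : 'rV[R]_n => x ord0 i) (fun u : R => u ^+ 2)).
    exact: coord_continuous.
  exact: exprn_continuous.
exact: sqrt_continuous.
Qed.

Lemma continuous_enorm_dist y : continuous (fun x => enorm (x - y)).
Proof.
move=> x; apply: (@continuous_comp _ _ _ (fun x => x - y) (@enorm R n)).
  apply: (@continuousB _ _ _ id (fun=> y)); first by move=> A.
  exact: cst_continuous.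
exact: continuous_enorm.
Qed.

Lemma lip1_continuous (f : 'rV[R]_n -> R) : lip1 f -> continuous f.
Proof.
move=> lf x; apply/(@cvgrPdist_lt _ _ _ (nbhs x) _ f (f x)) => e e0.
have := cvgr_lt _ (@continuous_enorm_dist x x) e.
rewrite subrr enorm0 => /(_ _ e0); apply: filterS => y h.
by apply: le_lt_trans h; rewrite enorm_distC.
Qed.

Lemma continuous_measurable_Rn (f : 'rV[R]_n -> R) : continuous f ->
  measurable_fun [set: Rn R n] (f : Rn R n -> R).
Proof.
move=> cf; apply: (measurability _ (RGenOInfty.measurableE R)).
move=> _ [_ [a ->] <-]; rewrite setTI; apply: sub_sigma_algebra.
by move/continuousP: cf; apply; rewrite set_itvE; exact: open_gt.
Qed.

End EuclideanNorm.

(** * Suprema over Euclidean balls and enlargements of superlevel sets *)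

Section SupBall.
Variables (R : realType) (n : nat).
Implicit Types x y : 'rV[R]_n.
Implicit Types (f : 'rV[R]_n -> R) (A : set 'rV[R]_n) (e : R).

Definition sup_ball f e x : R := sup [set f y | y in [set y | enorm (x - y) <= e]].

Lemma sup_ball_bound f e x : lip1 f ->
  ubound [set f y | y in [set y | enorm (x - y) <= e]] (f x + e).
Proof.
move=> lf _ [y /= xy <-]; have := lf y x.
by rewrite ler_norml => /andP[_]; rewrite enorm_distC; lra.
Qed.

Lemma le_sup_ball f e x y : lip1 f -> enorm (x - y) <= e -> f y <= sup_ball f e x.
Proof.
move=> lf xy; apply: ub_le_sup; last by exists y.
by exists (f x + e); exact: sup_ball_bound.
Qed.

Lemma sup_ball_le f e x (M : R) : 0 <= e ->
  (forall y, enorm (x - y) <= e -> f y <= M) -> sup_ball f e x <= M.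
Proof.
move=> e0 fM; apply: ge_sup; first by exists (f x), x => //=; rewrite subrr enorm0.
by move=> _ [y /= xy <-]; exact: fM.
Qed.

Lemma sup_ball_itv f e x : lip1 f -> 0 <= e -> f x <= sup_ball f e x <= f x + e.
Proof.
move=> lf e0; apply/andP; split; first by apply: le_sup_ball => //; rewrite subrr enorm0.
apply: sup_ball_le => // y xy.
by apply: (sup_ball_bound (x := x) lf); exists y.
Qed.

(** A competitor [z] in the ball around [x], translated by [y - x], is a competitor around [y]. *)
Lemma lip1_sup_ball f e : lip1 f -> 0 <= e -> lip1 (sup_ball f e).
Proof.
move=> lf e0.
suff h x y : sup_ball f e x - sup_ball f e y <= enorm (x - y).
  by move=> x y; rewrite ler_norml lerNl opprB h enorm_distC h.
rewrite lerBlDr; apply: sup_ball_le => // z xz.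
have := lf z (y + (z - x)).
have -> : z - (y + (z - x)) = x - y by rewrite opprD addrA opprB addrC addrA subrK.
move=> /ler_normlP[_ h].
have : f (y + (z - x)) <= sup_ball f e y.
  by apply: le_sup_ball => //; rewrite opprD addrA subrr sub0r opprB.
lra.
Qed.

Lemma dist_set_leP x A e : (dist_set x A <= e%:E)%E ->
  forall dl : R, 0 < dl -> exists2 y, A y & enorm (x - y) < e + dl.
Proof.
move=> h dl dl0.
have : (dist_set x A < (e + dl)%:E)%E by rewrite (le_lt_trans h)// lte_fin ltrDl.
by move=> /ereal_inf_lt[_ [y Ay <-]]; rewrite lte_fin => xy; exists y.
Qed.

(** The infimum defining the distance need not be attained, hence the slack [1 / (k + 1)]; the
    enlargement is thus a countable intersection of open sets. *)
Lemma enlargement_bigcap A e :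
  enlargement A e = \bigcap_(k in [set: nat])
     \bigcup_(y in A) [set x | enorm (x - y) < e + k.+1%:R^-1].
Proof.
apply/seteqP; split=> x.
  move=> h k _; have k0 : 0 < k.+1%:R^-1 :> R by rewrite invr_gt0.
  by have [y Ay xy] := dist_set_leP h k0; exists y.
move=> h; apply/lee_addgt0Pr => dl dl0.
have [k _ kdl] := near_infty_natSinv_lt (PosNum dl0).
have [y Ay /= xy] := h k I.
apply: (@le_trans _ _ (enorm (x - y))%:E); first by apply: ereal_inf_lbound; exists y.
rewrite lee_fin (le_trans (ltW xy))// lerD2l ltW//.
exact: (kdl k (leqnn _)).
Qed.

Lemma measurable_enlargement A e : measurable (enlargement A e : set (Rn R n)).
Proof.
rewrite enlargement_bigcap; apply: bigcapT_measurable => k.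
apply: sub_sigma_algebra; apply: bigcup_open => y _.
have /continuousP h := @continuous_enorm_dist R n y.
exact: (h _ (@open_lt R (e + k.+1%:R^-1))).
Qed.

(** A point [y] of the superlevel set within [e + dl] of [x] is contracted towards [x] by the factor
    [e / (e + dl)]. The result lies in the closed ball of radius [e], and [f] drops by at most
    [dl]. *)
Lemma enlargement_superlevel f e t : lip1 f -> 0 < e ->
  enlargement [set x | t <= f x] e `<=` [set x | t <= sup_ball f e x].
Proof.
move=> lf e0 x h /=; apply/ler_addgt0Pr => dl dl0.
have [y /= ty xy] := dist_set_leP h dl0.
have ed0 : 0 < e + dl by rewrite addr_gt0.
pose s := e / (e + dl).
have s0 : 0 <= s by rewrite divr_ge0// ltW.
have s1 : s <= 1 by rewrite ler_pdivrMr// mul1r lerDl ltW.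
pose z := x + s *: (y - x).
have xz : enorm (x - z) <= e.
  rewrite /z opprD addrA subrr sub0r -scalerN opprB enormZ//.
  apply: (@le_trans _ _ (s * (e + dl))); first by rewrite ler_wpM2l// ltW.
  by rewrite /s divfK ?gt_eqF.
have yz : enorm (y - z) <= dl.
  rewrite (_ : y - z = (1 - s) *: (y - x)); last first.
    by rewrite /z scalerBl scale1r opprD addrA.
  rewrite enormZ ?subr_ge0// enorm_distC.
  apply: (@le_trans _ _ ((1 - s) * (e + dl))).
    by rewrite ler_wpM2l ?subr_ge0// ltW.
  by rewrite mulrBl mul1r /s divfK ?gt_eqF// addrC addKr.
have := le_sup_ball lf xz; have := lf y z; rewrite ler_norml => /andP[_].
lra.
Qed.

End SupBall.

(** * Boundary measure against flux, and the Cheeger inequality *)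

Section Isoperimetry.
Variables (R : realType) (n : nat) (nu : probability (Rn R n) R).
Implicit Types (f : 'rV[R]_n -> R) (A : set 'rV[R]_n).
Local Open Scope ereal_scope.

Definition sup_balls f (k : nat) : 'rV[R]_n -> R := sup_ball f k.+1%:R^-1.

Lemma measurable_lip1 f : lip1 f -> measurable_fun [set: Rn R n] (f : Rn R n -> R).
Proof. by move=> lf; exact: continuous_measurable_Rn (lip1_continuous lf). Qed.

Lemma measurable_superlevel f t : lip1 f ->
  measurable ([set x | (t <= f x)%R] : set (Rn R n)).
Proof.
move=> lf; rewrite -[X in measurable X]setTI.
by apply: measurable_fun_le => //; exact: measurable_lip1.
Qed.

Lemma boundary_measure_ge0 (A : set (Rn R n)) :
  measurable A -> 0 <= boundary_measure nu A.
Proof.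
move=> mA; rewrite /boundary_measure limf_einfE.
apply: le_ereal_sup_tmp; exists (ereal_inf [set (nu (enlargement A e) - nu A) / e%:E
   | e in [set e : R | (0 < e)%R]]).
  exists [set e : R | (0 < e)%R] => //; exact: nbhs_right_gt.
apply: le_ereal_inf_tmp => _ [e /= e0 <-].
rewrite inver gt_eqF// mule_ge0 ?lee_fin ?invr_ge0 ?(ltW e0)//.
rewrite sube_ge0; last by rewrite fin_num_measure.
apply: le_measure; rewrite ?inE//; first exact: measurable_enlargement.
move=> x Ax; apply: (@le_trans _ _ (enorm (x - x))%:E).
  by apply: ereal_inf_lbound; exists x.
by rewrite lee_fin subrr enorm0 ltW.
Qed.

(** The liminf over all radii is at most the one along [1 / (k + 1)], and the collar added by the
    enlargement lies in the band counted by [level_flux]. *)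
Lemma boundary_measure_le f t : lip1 f ->
  boundary_measure nu [set x | (t <= f x)%R] <=
  limn_einf (fun k => level_flux nu f (sup_balls f) k t).
Proof.
move=> lf; rewrite /boundary_measure limf_einfE.
apply: ge_ereal_sup => _ [V [dl /= dl0 Vdl] <-].
apply: limn_einf_ge_near.
near=> k.
apply: (@le_trans _ _ ((nu (enlargement [set x | (t <= f x)%R] k.+1%:R^-1) -
    nu [set x | (t <= f x)%R]) / k.+1%:R^-1%:E)).
  apply: ereal_inf_lbound; exists k.+1%:R^-1%R => //.
  apply: Vdl; last by rewrite invr_gt0.
  rewrite /= sub0r normrN gtr0_norm ?invr_gt0//.
  by near: k; exact: near_infty_natSinv_lt (PosNum dl0).
rewrite inver gt_eqF ?invr_gt0// invrK muleC /level_flux.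
rewrite lee_wpmul2l// leeBlDl; last first.
  by rewrite fin_num_measure//; exact: measurable_superlevel.
set e : R := k.+1%:R^-1%R.
have e0 : (0 < e)%R by rewrite invr_gt0.
have mF : measurable_fun [set: Rn R n] (sup_balls f k : Rn R n -> R).
  by apply: measurable_lip1; apply: lip1_sup_ball => //; exact: ltW.
have mb : measurable [set x : Rn R n | (f x < t <= sup_balls f k x)%R].
  by apply: measurable_band => //; exact: measurable_lip1.
apply: (@le_trans _ _ (nu ([set x | (t <= f x)%R] `|`
    [set x | (f x < t <= sup_balls f k x)%R]))); last first.
  by apply: measureU2 => //; exact: measurable_superlevel.
apply: le_measure; rewrite ?inE.
- exact: measurable_enlargement.
- by apply: measurableU => //; exact: measurable_superlevel.
move=> x /(enlargement_superlevel lf e0) /= tx.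
by have [tf|ft] := leP t (f x); [left|right].
Unshelve. all: by end_near. Qed.

Lemma cheeger_le (A : set (Rn R n)) (al I : R) : measurable A -> (0 < al)%R ->
  (0 < I)%R -> cheeger nu al <= I%:E ->
  mine (nu A) (1 - nu A) <= I%:E * boundary_measure nu A `^ al.
Proof.
move=> mA al0 I0 hI.
have : mine (nu A) (1 - nu A) / boundary_measure nu A `^ al <= I%:E.
  by apply: le_trans hI; apply: ereal_sup_ubound; exists A.
have : 0 <= mine (nu A) (1 - nu A).
  by rewrite le_min measure_ge0 sube_ge0 ?fin_num_measure// probability_le1.
have := poweR_ge0 (boundary_measure nu A) al.
case: (boundary_measure nu A `^ al) => [b||]//; last first.
  by move=> _ _ _; rewrite gt0_muley ?lte_fin// leey.
(* With a zero denominator the numerator must vanish, since the ratio would otherwise be [+oo]. *)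
rewrite lee_fin le_eqVlt => /predU1P[<-|b0].
  rewrite inve0 le_eqVlt mule0 => /predU1P[<- //|m0].
  by rewrite gt0_muley.
move=> _.
by rewrite inver gt_eqF// -EFinM lee_pdivrMr// muleC.
Qed.

End Isoperimetry.

(** * Medians and gradients *)

Section MedianGradient.
Variables (R : realType) (n : nat) (nu : probability (Rn R n) R).
Implicit Types (f : 'rV[R]_n -> R).
Local Open Scope ereal_scope.

(** The distribution function tends to [1] at [+oo] and to [0] at [-oo]; so [median] is a true
    infimum and not a default value of [inf]. *)
Lemma median_set_nonempty f : measurable_fun [set: Rn R n] (f : Rn R n -> R) ->
  has_inf [set t : R | (2^-1)%:E <= nu [set x | (f x <= t)%R]].
Proof.
move=> mf.
pose X : {RV nu >-> R} := HB.pack (f : Rn R n -> R) 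
  (@isMeasurableFun.Build _ _ (Rn R n) R (f : Rn R n -> R) mf).
have cdfE t : cdf X t = nu [set x | (f x <= t)%R].
  by rewrite /cdf /distribution /pushforward; congr (nu _).
split.
  have /fine_cvgP[fX cX] : cdf X t @[t --> +oo%R] --> 1%:E := cvg_cdfy1 X.
  have lt1 : (2^-1 < 1 :> R)%R by lra.
  have [t [ft ht]] := filter_ex (filterI fX (cvgr_gt _ cX _ lt1)).
  by exists t; rewrite /= -cdfE -(fineK ft) lee_fin ltW.
have /fine_cvgP[fX cX] : cdf X t @[t --> -oo%R] --> 0%:E := cvg_cdfNy0 X.
have gt0 : (0 < 2^-1 :> R)%R by lra.
have [t [ft ht]] := filter_ex (filterI fX (cvgr_lt _ cX _ gt0)).
exists t => s /= hs; rewrite leNgt; apply/negP => st.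
have : nu [set x | (f x <= s)%R] <= nu [set x | (f x <= t)%R].
  apply: le_measure; rewrite ?inE.
  - by rewrite -[X in measurable X]setTI; exact: measurable_fun_le.
  - by rewrite -[X in measurable X]setTI; exact: measurable_fun_le.
  by move=> x /= /le_trans; apply; exact: ltW.
move=> /(le_trans hs); rewrite -cdfE -(fineK ft) lee_fin leNgt.
by rewrite ht.
Qed.

Lemma superlevel_above_median f t : measurable_fun [set: Rn R n] (f : Rn R n -> R) ->
  (median nu f < t)%R -> nu [set x | (t <= f x)%R] <= (2^-1)%:E.
Proof.
move=> mf mt.
have [s /= Ss st] := inf_lt (median_set_nonempty mf).1 mt.
have ms : measurable [set x : Rn R n | (f x <= s)%R].
  rewrite -[X in measurable X]setTI; exact: measurable_fun_le.
have mt' : measurable [set x : Rn R n | (t <= f x)%R].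
  rewrite -[X in measurable X]setTI; exact: measurable_fun_le.
apply: (@le_trans _ _ (nu (~` [set x | (f x <= s)%R]))).
  apply: le_measure; rewrite ?inE//; first exact: measurableC.
  by move=> x /= tx; apply/negP; rewrite -ltNge (lt_le_trans st).
rewrite probability_setC// leeBlDl ?fin_num_measure//.
apply: (@le_trans _ _ ((2^-1)%:E + (2^-1)%:E)); last by rewrite leeD2r.
by rewrite -EFinD lee_fin; lra.
Qed.

Lemma sublevel_below_median f t : measurable_fun [set: Rn R n] (f : Rn R n -> R) ->
  (t < median nu f)%R -> nu [set x | (f x < t)%R] <= (2^-1)%:E.
Proof.
move=> mf tm.
have ms : measurable [set x : Rn R n | (f x <= t)%R].
  rewrite -[X in measurable X]setTI; exact: measurable_fun_le.
have mt' : measurable [set x : Rn R n | (t <= f x)%R].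
  rewrite -[X in measurable X]setTI; exact: measurable_fun_le.
apply: (@le_trans _ _ (nu [set x | (f x <= t)%R])).
  apply: le_measure; rewrite ?inE//.
    rewrite (_ : [set x | (f x < t)%R] = ~` [set x | (t <= f x)%R]).
      exact: measurableC.
    by apply/seteqP; split=> x /=; rewrite ltNge => /negP.
  by move=> x /= /ltW.
rewrite leNgt; apply/negP => /ltW h.
have := ge_inf (median_set_nonempty mf).2 h.
by rewrite leNgt tm.
Qed.

(** By the choice of the median the tail at [t] has measure at most one half, so it is bounded by
    the minimum in the Cheeger inequality. For both signs of [t] that inequality is applied to the
    superlevel set. *)
Lemma level_isoperimetry f (al I t : R)
    (phi := fun x => (f x - median nu f)%R) : lip1 f -> (0 < al)%R -> (0 < I)%R ->
  cheeger nu al <= I%:E -> (t != 0)%R ->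
  nu (if (0 < t)%R then [set x | (t <= phi x)%R] else [set x | (phi x < t)%R])
    <= I%:E * limn_einf (fun k => level_flux nu phi (sup_balls phi) k t) `^ al.
Proof.
move=> lf al0 I0 hI t0.
have lphi : lip1 phi by move=> x y; rewrite /phi opprB addrA subrK.
have mf : measurable_fun [set: Rn R n] (f : Rn R n -> R) by exact: measurable_lip1.
have mA : measurable ([set x | (t <= phi x)%R] : set (Rn R n)).
  exact: measurable_superlevel.
have AE : [set x | (phi x < t)%R] = ~` [set x | (t <= phi x)%R].
  by apply/seteqP; split=> x /=; rewrite ltNge => /negP.
have half (c : \bar R) : c <= (2^-1)%:E -> c <= 1 - c.
  case: c => [c||]//; rewrite -EFinB !lee_fin; lra.
apply: (@le_trans _ _ (mine (nu [set x | (t <= phi x)%R])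
    (1 - nu [set x | (t <= phi x)%R]))).
  case: ltP t0 => [t0 _|].
    rewrite le_min lexx /=; apply: half.
    have := @superlevel_above_median f (t + median nu f)%R mf.
    rewrite ltrDr => /(_ t0); congr (nu _ <= _).
    by apply/seteqP; split=> x /=; rewrite /phi lerBrDr.
  rewrite le_eqVlt => /predU1P[-> /eqP//|t0 _].
  have h : nu [set x | (phi x < t)%R] <= (2^-1)%:E.
    have := @sublevel_below_median f (t + median nu f)%R mf.
    rewrite gtrDr => /(_ t0); congr (nu _ <= _).
    by apply/seteqP; split=> x /=; rewrite /phi ltrBlDr.
  rewrite le_min; apply/andP; split; last by rewrite AE probability_setC.
  apply: (le_trans (half _ h)); rewrite -probability_setC AE ?setCK//.
  exact: measurableC.
apply: (le_trans (@cheeger_le _ _ nu _ _ _ mA al0 I0 hI)).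
rewrite lee_wpmul2l ?lee_fin ?(ltW I0)//.
have b0 := @boundary_measure_ge0 _ _ nu _ mA.
have bg := @boundary_measure_le _ _ nu phi t lphi.
apply: gt0_ler_poweR => //; first exact: ltW.
  by rewrite in_itv /= b0 leey.
by rewrite in_itv /= (le_trans b0 bg) leey.
Qed.

(** A bound [s] on the difference quotients in a punctured neighbourhood bounds [f y - f x] by
    [s / (k + 1)] on the ball of radius [1 / (k + 1)], once this ball fits in the neighbourhood. *)
Lemma quotient_sup_le_grad f x : (0 < n)%N -> lip1 f ->
  quotient_sup f (sup_balls f) x <= grad_norm f x.
Proof.
move=> n0 lf; apply: le_ereal_inf_tmp => _ [V xV <-].
set s := ereal_sup _.
have /nbhs_ballP[dl /= dl0 dlV] : nbhs x [set y | y != x -> V y] by exact: xV.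
have dV y : y != x -> (forall i, `|x ord0 i - y ord0 i| < dl)%R -> V y.
  by move=> yx xy; apply: dlV => //; split=> // i j; rewrite (ord1 i); exact: xy.
have ratio y : V y -> (`|f x - f y| / enorm (x - y))%:E <= s.
  by move=> Vy; apply: ereal_sup_ubound; exists y.
(* Positive dimension provides a point of [V] other than [x], so the supremum is not over the empty
   set. *)
have s0 : 0 <= s.
  pose y : 'rV[R]_n := (x + const_mx (dl / 2))%R.
  apply: (@le_trans _ _ (`|f x - f y| / enorm (x - y))%:E).
    by rewrite lee_fin divr_ge0 ?enorm_ge0.
  apply: ratio; apply: dV => [|i].
    apply/eqP => /matrixP/(_ ord0 (Ordinal n0)); rewrite /y !mxE; lra.
  rewrite /y !mxE opprD addrA subrr sub0r normrN gtr0_norm; lra.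
apply: limn_esup_le_near; near=> k.
have ke : (k.+1%:R^-1 < dl)%R by near: k; exact: near_infty_natSinv_lt (PosNum dl0).
case: s s0 ratio => [s||//] s0 ratio; last by rewrite leey.
rewrite lee_fin in s0.
rewrite lee_fin -ler_pdivlMl// lerBlDl.
apply: sup_ball_le => // y xy.
have [e0|e0] := eqVneq (enorm (x - y)%R) 0%R.
  have := lf y x; rewrite enorm_distC e0 normr_le0 subr_eq0 => /eqP ->.
  by rewrite lerDl mulr_ge0.
have e_gt0 : (0 < enorm (x - y))%R by rewrite lt_neqAle eq_sym e0 enorm_ge0.
have Vy : V y.
  apply: dV => [|i].
    by apply: contra_neq e0 => ->; rewrite subrr enorm0.
  have := coord_le_enorm (x - y)%R i; rewrite !mxE => /le_lt_trans; apply.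
  exact: le_lt_trans xy ke.
have := ratio _ Vy; rewrite lee_fin ler_pdivrMr// distrC => /(le_trans (ler_norm _)).
rewrite lerBlDl => /le_trans; apply; rewrite lerD2l mulrC ler_wpM2r//.
Unshelve. all: by end_near. Qed.

End MedianGradient.

(** * Removal of the truncation and degenerate cases *)

Section MomentBound.
Variable R : realType.

(** Provides the small positive parameter that replaces a zero Cheeger constant or a zero slope
    integral. *)
Lemma powR_small (a K e : R) : 0 < a -> 0 <= K -> 0 < e ->
  exists2 t : R, 0 < t <= 1 & K * t `^ a <= e.
Proof.
move=> a0 K0 e0.
pose t := Num.min 1 ((e / (K + 1)) `^ a^-1).
have ep : 0 < e / (K + 1) by rewrite divr_gt0//; lra.
have t0 : 0 < t by rewrite lt_min ltr01 powR_gt0.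
exists t; first by rewrite t0 ge_min lexx.
have : t `^ a <= e / (K + 1).
  rewrite -[leRHS](powRr1 (ltW ep)) -[X in _ <= _ `^ X](mulVf (lt0r_neq0 a0)) powRrM.
  by rewrite ge0_ler_powR ?nnegrE ?powR_ge0 ?(ltW a0) ?(ltW t0)// ge_min lexx orbT.
rewrite ler_pdivlMr; last lra.
move=> h; apply: le_trans h; rewrite mulrC ler_wpM2l ?powR_ge0//; lra.
Qed.

Lemma C1_const_ge0 (al be I : R) : 0 < al -> 0 < al - be * (1 - al) ->
  0 <= C1_const al be I.
Proof.
move=> al0 a0; rewrite /C1_const mulr_ge0 ?powR_ge0// addr_ge0//.
by rewrite !mulr_ge0 ?powR_ge0 ?invr_ge0 ?(ltW al0) ?(ltW a0).
Qed.

Variables (n : nat) (nu : probability (Rn R n) R).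
Variables (al be : R).
Hypotheses (al_half : 2^-1 < al < 1) (hbe : 1 <= be < al / (1 - al)).
Let a := al - be * (1 - al).
Variable f : 'rV[R]_n -> R.
Hypothesis lf : lip1 f.
Let phi (x : Rn R n) : R := f x - median nu f.
Let slope (x : Rn R n) : \bar R := quotient_sup phi (sup_balls phi) x.

Let al01 : 0 < al < 1.
Proof. by move: al_half => /andP[h1 ->]; rewrite andbT (lt_trans _ h1). Qed.

Let a0 : 0 < a.
Proof.
have [al0 al1] := andP al01; have /andP[_] := hbe.
by rewrite /a ltr_pdivlMr subr_gt0// .
Qed.

Let lphi : lip1 phi.
Proof. by move=> x y; rewrite /phi opprB addrA subrK; exact: lf. Qed.

Let mphi : measurable_fun [set: Rn R n] phi.
Proof. exact: measurable_lip1 lphi. Qed.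

Let msup k : measurable_fun [set: Rn R n] (sup_balls phi k : Rn R n -> R).
Proof. by apply: measurable_lip1; apply: lip1_sup_ball => //; rewrite invr_ge0. Qed.

Let phi_sup k x : phi x <= sup_balls phi k x <= phi x + k.+1%:R^-1.
Proof. by apply: sup_ball_itv => //; rewrite invr_ge0. Qed.

Let slope01 x : (0 <= slope x <= 1)%E.
Proof. exact: (quotient_sup_ge0_le1 phi_sup x). Qed.

Let D : R := fine (\int[nu]_x slope x)%E.

Lemma integral_slope_fin : (\int[nu]_x slope x = D%:E /\ 0 <= D%:E <= 1)%E.
Proof.
by have [i01 ifin] := integral_bounded nu (B := 1) slope01; rewrite /D fineK.
Qed.

(** Positive majorants [I] and [D'] replace the Cheeger constant and the slope integral, so that the
    case where either vanishes follows by a limit. *)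
Lemma moment_le (I D' : R) : 0 < I -> (cheeger nu al <= I%:E)%E ->
  D <= D' -> 0 < D' <= 1 ->
  ('E_nu[fun x => (`|f x - median nu f| `^ be)%R] <= (C1_const al be I * D' `^ a)%:E)%E.
Proof.
move=> I0 hI DD' D'01.
have [al0 al1] := andP al01; have [be1 bep] := andP hbe.
have be0 : 0 <= be by exact: le_trans be1.
set p := al / (1 - al) in bep.
have pal : p * (1 - al) = al by rewrite divfK// gt_eqF// subr_gt0.
have iso t : t != 0 -> (nu (if (0 < t)%R then [set x | (t <= phi x)%R]
    else [set x | (phi x < t)%R]) <=
    I%:E * limn_einf (fun k => level_flux nu phi (sup_balls phi) k t) `^ al)%E.
  exact: level_isoperimetry.
have trunc (N : R) : 0 <= N ->
    (\int[nu]_x (`|clamp N (phi x)| `^ be)%:E <= (C1_const al be I * D' `^ a)%:E)%E.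
  move=> N0.
  set S := (\int[nu]_x _)%E.
  have Sfin : S \is a fin_num.
    suff h x : (0 <= (`|clamp N (phi x)| `^ be)%:E <= (N `^ be)%:E)%E.
      by have [] := integral_bounded nu h.
    rewrite !lee_fin powR_ge0 ge0_ler_powR ?nnegrE//.
    exact: normr_clamp_le.
  rewrite -(fineK Sfin) lee_fin.
  apply: (optimize_radius al01 be1 (erefl p)) => // r r0.
  apply: (le_trans (truncated_moment_le mphi msup phi_sup al01 be1 pal bep I0 iso N0 r0)).
  rewrite lerD2r ler_wpM2l// mulr_ge0 ?(ltW r0)// subr_ge0.
  rewrite ler_pdivrMr ?(lt_le_trans ltr01)//.
  by rewrite mul1r ltW// (lt_le_trans al1).
rewrite unlock.
(* At each point the truncation is eventually inactive, so Fatou's lemma transfers the uniform bound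
   to the full moment. *)
apply: (@le_trans _ _ (\int[nu]_x limn_einf (fun N : nat =>
    (`|clamp N%:R (phi x)| `^ be)%:E))%E).
  apply: ge0_le_lower_integral => x; rewrite lee_fin powR_ge0/=.
  apply: limn_einf_ge_near; near=> N.
  rewrite clamp_id// -ler_norml.
  by near: N; exact: (nbhs_infty_ger `|phi x|).
apply: (le_trans (fatou _ _ _ _)) => //.
  move=> N; apply/measurable_EFinP.
  have mpow : measurable_fun [set: R] (fun y => `|clamp N%:R y| `^ be).
    apply: continuous_measurable_fun => y.
    apply: (@continuous_comp _ _ _ (clamp N%:R) (fun t => `|t| `^ be)).
      exact: continuous_clamp.
    exact: continuous_norm_powR.
  exact: measurableT_comp mpow mphi.
apply: (le_trans (limn_einf_sup _)); apply: limn_esup_le_near; apply: nearW => N.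
exact: trunc.
Unshelve. all: by end_near. Qed.

(* For [n = 0] the filter [x^'] is trivial and [grad_norm f x = -oo]. *)
Lemma slope_le_grad :
  (((\int[nu]_x slope x) `^ a) <= (\int[nu]_x grad_norm f x) `^ a)%E.
Proof.
have [ED /andP[D0 D1]] := integral_slope_fin.
have [n0|n0] := posnP n.
  suff -> : (\int[nu]_x slope x = 0)%E by rewrite poweR0r ?poweR_ge0// gt_eqF.
  rewrite integral0_eq// => x _.
  have yx y : y = x.
    by apply/matrixP => i j; have := ltn_ord j; rewrite [X in (_ < X)%N]n0 ltn0.
  apply/eqP; rewrite eq_le; case/andP: (slope01 x) => -> _; rewrite andbT.
  apply: limn_esup_le_near; apply: nearW => k.
  rewrite lee_fin mulr_ge0_le0// subr_le0.
  by apply: sup_ball_le => [|y _]; rewrite ?invr_ge0// (yx y).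
have le_int : (\int[nu]_x slope x <= \int[nu]_x grad_norm f x)%E.
  apply: ge0_le_lower_integral => x; case/andP: (slope01 x) => -> _ /=.
  have := quotient_sup_le_grad x n0 lphi; congr (_ <= _)%E.
  rewrite /grad_norm; congr limf_esup; apply/funext => y.
  by rewrite /phi opprB addrA subrK.
apply: gt0_ler_poweR => //; first exact: ltW.
  by rewrite in_itv /= leey ED D0.
by rewrite in_itv /= leey (le_trans _ le_int)// ED D0.
Qed.

Lemma moment_le_slope : (cheeger nu al < +oo)%E ->
  ('E_nu[fun x => (`|f x - median nu f| `^ be)%R] <=
    (C1_const al be (fine (cheeger nu al)) * D `^ a)%:E)%E.
Proof.
move=> hI.
have [al0 al1] := andP al01.
have ch0 : (0 <= cheeger nu al)%E.
  apply: le_ereal_sup_tmp.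
  exists (mine (nu set0) (1 - nu set0) / boundary_measure nu set0 `^ al)%E.
    by exists set0.
  by rewrite measure0 sube0 min_l ?lee01// mul0e.
have chE : (cheeger nu al)%E = (fine (cheeger nu al))%:E.
  by rewrite fineK// ge0_fin_numE.
set I := fine (cheeger nu al) in chE *.
have I0 : 0 <= I by rewrite fine_ge0.
have [_ D01] := integral_slope_fin.
rewrite !lee_fin in D01; case/andP: D01 => D0 D1.
have RHS0 : 0 <= C1_const al be I * D `^ a by rewrite mulr_ge0 ?powR_ge0 ?C1_const_ge0.
have [Ipos|] := ltP 0 I; last first.
  (* A zero Cheeger constant is majorized by any [t] in []0, 1]]; with [D' = 1] the bound is at most
     [K * t^a], which is arbitrarily small. *)
  move=> Ile0; have I00 : I = 0 by apply/le_anti; rewrite Ile0.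
  apply: (@le_trans _ _ 0%:E); last by rewrite lee_fin.
  apply/lee_addgt0Pr => e e0; rewrite add0e.
  pose K := 1 + 2 * (al / (1 - al)) `^ be * (al / a).
  have ala0 : 0 <= al / a by rewrite divr_ge0 ?(ltW al0) ?(ltW a0).
  have K0 : 0 <= K by rewrite addr_ge0// mulr_ge0// mulr_ge0 ?powR_ge0.
  have [t t01 Kt] := powR_small a0 K0 e0; have [t0 t1] := andP t01.
  apply: (le_trans (moment_le t0 _ D1 _)).
  - by rewrite chE I00 lee_fin ltW.
  - by rewrite ltr01 lexx.
  rewrite lee_fin powR1 mulr1; apply: le_trans Kt.
  rewrite /C1_const -/a mulrC ler_wpM2r ?powR_ge0// lerD2l.
  rewrite ler_wpM2r// ler_wpM2r ?powR_ge0// ler_piMr//.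
  have be0 : 0 <= be / al.
    by rewrite divr_ge0 ?(ltW al0)//; case/andP: hbe => be1 _; exact: le_trans be1.
  apply: (@le_trans _ _ (1 `^ (be / al))); last by rewrite powR1.
  by rewrite ge0_ler_powR ?nnegrE ?(ltW t0).
have [Dpos|Dneg] := ltP 0 D.
  by apply: moment_le; rewrite ?chE ?Dpos.
(* Here [D = 0], and [D' = t] is sent to [0]. *)
apply: (@le_trans _ _ 0%:E); last by rewrite lee_fin.
apply/lee_addgt0Pr => e e0; rewrite add0e.
have [t t01 Kt] := powR_small a0 (C1_const_ge0 I al0 a0) e0; have [t0 t1] := andP t01.
apply: (le_trans (moment_le Ipos _ _ t01)); last by rewrite lee_fin.
- by rewrite chE.
- by rewrite (le_trans Dneg)// ltW.
Qed.

End MomentBound.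

Theorem theorem1p2 (R : realType) (n : nat) (nu : probability (Rn R n) R)
    (alpha : R) (halpha : 2^-1 < alpha < 1)
    (hI : (cheeger nu alpha < +oo)%E)
    (beta : R) (hbeta : 1 <= beta < alpha / (1 - alpha)) :
  let a := alpha - beta * (1 - alpha) in
  let C := C1_const alpha beta (fine (cheeger nu alpha)) in
  (forall f : 'rV[R]_n -> R, lip1 f ->
     ('E_nu[fun x => (`|f x - median nu f| `^ beta)%R]
      <= C%:E * (\int[nu]_x grad_norm f x) `^ a)%E)
  /\ (poincare nu a beta <= C%:E)%E.
Proof.
have [be1 bep] := andP hbeta.
move=> a C.
have al01 : 0 < alpha < 1.
  by have /andP[h1 h2] := halpha; rewrite h2 andbT (lt_trans _ h1).
have [al0 al1] := andP al01.
have a0 : 0 < a by rewrite subr_gt0 -ltr_pdivlMr ?subr_gt0.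
have C0 : 0 <= C by exact: C1_const_ge0.
have bound f : lip1 f -> ('E_nu[fun x => (`|f x - median nu f| `^ beta)%R]
      <= C%:E * (\int[nu]_x grad_norm f x) `^ a)%E.
  move=> lf; apply: (le_trans (moment_le_slope halpha hbeta lf hI)).
  rewrite EFinM; apply: lee_wpmul2l; first by rewrite lee_fin.
  apply: le_trans (slope_le_grad nu halpha hbeta lf).
  by rewrite (integral_slope_fin nu lf).1.
split=> //; apply: ge_ereal_sup => _ [f lf <-].
have := bound f lf.
have : (0 <= 'E_nu[fun x => (`|f x - median nu f| `^ beta)%R])%E.
  by rewrite unlock; apply: integral_ge0 => x _; rewrite lee_fin powR_ge0.
have := poweR_ge0 (\int[nu]_x grad_norm f x)%E a.
move: ('E_nu[_])%E (_ `^ a)%E => E [y||]//.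
(* If the denominator is [0], the first part forces a zero numerator and the ratio reads [0]; if it
   is [+oo], its inverse is [0]. *)
- rewrite lee_fin => y0 E0; have [->|yn0] := eqVneq y 0.
    rewrite mule0 => E_le0; have -> : E = 0%E by apply/eqP; rewrite eq_le E_le0.
    by rewrite mul0e lee_fin.
  by rewrite inver (negbTE yn0) lee_pdivrMr// lt_neqAle eq_sym yn0.
- by rewrite invey mule0 lee_fin.
Qed.
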